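(* Let $V$ be a $5$-dimensional real vector space with a Lorentz metric $g$ of signature $(-++++)$, and let $T=T^a{}_b$ be a real tensor that is symmetric with respect to $g$. Then $T$ is the superenergy tensor of a 2-form if and only if (a) $T$ satisfies the dominant energy condition, and (b) $\displaystyle\Bigl(T^2-\frac14[T^2]+\frac14[T]^2\Bigr)\bigl(T-[T]\bigr)=0$.
   Context: Indices are raised and lowered with $g$. $T$ symmetric with respect to $g$ means $g_{ac}T^c{}_b=g_{bc}T^c{}_a$. Index-free notation: products denote composition of $(1,1)$-tensors, $[X]=X^c{}_c$ is the trace, and scalar terms are multiplied by the identity $\delta^a_b$. $T$ is the superenergy tensor of a 2-form $F_{ab}$ if $T^a{}_b=F^{ac}F_{bc}-\frac14F^{cd}F_{cd}\delta^a_b$. The dominant energy condition means $T_{ab}u^av^b\geq0$ (with $T_{ab}=g_{ac}T^c{}_b$) for every pair of future-pointing causal vectors $u,v$. *)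

(* Defs.v *)
From HB Require Import structures.
From mathcomp Require Import all_boot all_order all_algebra.
From mathcomp Require Import reals.
Set Implicit Arguments. Unset Strict Implicit. Unset Printing Implicit Defensive.
Import Order.TTheory GRing.Theory Num.Theory.
Local Open Scope ring_scope.

(* Conventions: V = R^5 (column vectors 'cV_5), the metric g is the 5x5
   matrix g_ab (lower indices), a (1,1)-tensor T^a_b is the matrix with
   T i j = T^i_j, a 2-form F_ab is an antisymmetric matrix with lower indices.
   Index raising uses the inverse matrix g^ab = invmx g. *)

Section Defs.
Variable R : realType.

Definition gdot (g : 'M[R]_5) (u v : 'cV[R]_5) : R := (u^T *m g *m v) 0 0.

Definition minkowski5 : 'M[R]_5 :=
  \matrix_(i, j) (if i == j then (if i == ord0 then -1 else 1) else 0).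

(* g is a Lorentz metric of signature (-++++): congruent to diag(-1,1,1,1,1)
   (Sylvester's law of inertia); this entails symmetry and nondegeneracy. *)
Definition lorentz_metric (g : 'M[R]_5) : Prop :=
  exists P : 'M[R]_5, P \in unitmx /\ P^T *m g *m P = minkowski5.

Definition g_symmetric (g T : 'M[R]_5) : Prop := (g *m T)^T = g *m T.

Definition timelike (g : 'M[R]_5) (u : 'cV[R]_5) : Prop := gdot g u u < 0.

Definition causal (g : 'M[R]_5) (u : 'cV[R]_5) : Prop :=
  u != 0 /\ gdot g u u <= 0.

(* time orientation given by a timelike vector tau *)
Definition future_causal (g : 'M[R]_5) (tau u : 'cV[R]_5) : Prop :=
  causal g u /\ gdot g u tau < 0.

Definition dominant_energy (g : 'M[R]_5) (tau : 'cV[R]_5) (T : 'M[R]_5) : Prop :=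
  forall u v : 'cV[R]_5, future_causal g tau u -> future_causal g tau v ->
    0 <= (u^T *m (g *m T) *m v) 0 0.

Definition two_form (F : 'M[R]_5) : Prop := F^T = - F.

Definition raise2 (g F : 'M[R]_5) : 'M[R]_5 := invmx g *m F *m (invmx g)^T.

(* T^a_b = F^{ac} F_{bc} - 1/4 F^{cd} F_{cd} delta^a_b *)
Definition superenergy_of (g F : 'M[R]_5) : 'M[R]_5 :=
  raise2 g F *m F^T - ((4%:R)^-1 * \tr (raise2 g F *m F^T))%:M.

Definition is_superenergy (g T : 'M[R]_5) : Prop :=
  exists F : 'M[R]_5, two_form F /\ T = superenergy_of g F.

Definition condition_b (T : 'M[R]_5) : Prop :=
  (T *m T - ((4%:R)^-1 * \tr (T *m T))%:M + ((4%:R)^-1 * (\tr T) ^+ 2)%:M)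
    *m (T - (\tr T)%:M) = 0.

End Defs.

(* Main.v *)
Require Import Defs.
From HB Require Import structures.
From mathcomp Require Import all_boot all_order all_fingroup all_algebra.
From mathcomp Require Import reals ring lra.
Set Implicit Arguments. Unset Strict Implicit. Unset Printing Implicit Defensive.
Import Order.TTheory GRing.Theory Num.Theory.
Local Open Scope ring_scope.

(* In a g-orthonormal frame write F^a_b = A, so that T - [T] = - A^2.

   If T comes from F, condition (b) is the Cayley-Hamilton theorem for A: with
   k^a = (1/8) eps^{abcde} F_bc F_de one has A k = 0 and
   A^4 - (1/2)[A^2] A^2 + (1/8)[A^2]^2 - (1/4)[A^4] = - k k^t g. The dominant energy condition
   says that the energy density (|E|^2 + |B|^2)/2 bounds the flux B E.

   Conversely, put t = [T] and c = ([T^2] - t^2)/4, so that (b) reads (T^2 - c)(T - t) = 0. By the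
   dominant energy condition -T preserves the future cone, and since (T^2 - c)(T^2 - t^2) = 0 a
   power iteration yields a causal eigenvector k. If k is timelike, T is diagonalized in an
   orthonormal frame starting with k; the traces and the cubic equation force the spectrum to be
   (-l; -l, t, l, l) or (t; -b, -b, b, b), and A is a boost plus a rotation, or two rotations. If k
   is null, the same count forces (-l, -l, t, l, l); then either there is also a timelike
   eigenvector, or t = -l and A is a null rotation plus a spatial rotation. *)

Local Notation o0 := (@ord0 4).
Local Notation o1 := (lift (@ord0 4) (@ord0 3)).
Local Notation o2 := (lift (@ord0 4) (lift (@ord0 3) (@ord0 2))).
Local Notation o3 := (lift (@ord0 4) (lift (@ord0 3) (lift (@ord0 2) (@ord0 1)))).
Local Notation o4 :=
  (lift (@ord0 4) (lift (@ord0 3) (lift (@ord0 2) (lift (@ord0 1) (@ord0 0))))).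

(** * Frames *)

Lemma sum5 (V : nmodType) (f : 'I_5 -> V) :
  \sum_i f i = f o0 + f o1 + f o2 + f o3 + f o4.
Proof. by rewrite !big_ord_recl big_ord0 addr0 !addrA. Qed.

Lemma forall5 (Q : 'I_5 -> Prop) :
  Q o0 -> Q o1 -> Q o2 -> Q o3 -> Q o4 -> forall i, Q i.
Proof.
move=> h0 h1 h2 h3 h4 i.
case: (unliftP ord0 i) => [j ->|->] //.
case: (unliftP ord0 j) => [k ->|->] //.
case: (unliftP ord0 k) => [l ->|->] //.
case: (unliftP ord0 l) => [m ->|->] //.
by rewrite (ord1 m).
Qed.

(** * Bilinear forms and reflections *)

Section BilinearForms.
Variables (R : realType) (n : nat).
Implicit Types (M T P : 'M[R]_n) (u v : 'cV[R]_n).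

Definition bil M u v : R := (u^T *m M *m v) 0 0.

Lemma bilE M u v : bil M u v = \sum_i \sum_j u i 0 * M i j * v j 0.
Proof.
rewrite /bil mxE exchange_big; apply: eq_bigr => j _.
by rewrite mxE mulr_suml; apply: eq_bigr => i _; rewrite mxE.
Qed.
Lemma bilD1 M u1 u2 v : bil M (u1 + u2) v = bil M u1 v + bil M u2 v.
Proof. by rewrite /bil linearD !mulmxDl mxE. Qed.
Lemma bilD2 M u v1 v2 : bil M u (v1 + v2) = bil M u v1 + bil M u v2.
Proof. by rewrite /bil mulmxDr mxE. Qed.
Lemma bilZ1 M a u v : bil M (a *: u) v = a * bil M u v.
Proof. by rewrite /bil linearZ /= -!scalemxAl mxE. Qed.
Lemma bilZ2 M a u v : bil M u (a *: v) = a * bil M u v.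
Proof. by rewrite /bil -!scalemxAr mxE. Qed.
Lemma bilN1 M u v : bil M (- u) v = - bil M u v.
Proof. by rewrite -scaleN1r bilZ1 mulN1r. Qed.
Lemma bilN2 M u v : bil M u (- v) = - bil M u v.
Proof. by rewrite -scaleN1r bilZ2 mulN1r. Qed.
Lemma bil_sym M u v : M^T = M -> bil M u v = bil M v u.
Proof.
by move=> hM; rewrite /bil -[in RHS]hM -[v^T *m _ *m u]trmxK [RHS]mxE !trmx_mul !trmxK mulmxA.
Qed.
Lemma bil_frame M P u v : bil (P^T *m M *m P) u v = bil M (P *m u) (P *m v).
Proof. by rewrite /bil trmx_mul !mulmxA. Qed.
Lemma bilM2 M T u v : bil M u (T *m v) = bil (M *m T) u v.
Proof. by rewrite /bil !mulmxA. Qed.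
Lemma bilM1 M T u v : bil M (T *m u) v = bil (T^T *m M) u v.
Proof. by rewrite /bil trmx_mul !mulmxA. Qed.

Lemma bil_ext M N : (forall u v, bil M u v = bil N u v) -> M = N.
Proof.
move=> h; apply/matrixP => i j; have := h (delta_mx i 0) (delta_mx j 0).
by rewrite /bil trmx_delta -!rowE -!colE !mxE.
Qed.

(** As [x] and [y] have equal norms, [x + y] is orthogonal to [x - y]; so the reflection in the
    hyperplane orthogonal to [x - y] exchanges [x] and [y]. *)
Lemma reflection (g : 'M[R]_n) (x y : 'cV[R]_n) :
  g^T = g -> bil g x x = bil g y y -> bil g (x - y) (x - y) != 0 ->
  exists Q : 'M[R]_n, Q^T *m g *m Q = g /\ Q *m y = x.
Proof.
move=> hg hxy; have [w hw] : exists w, w = x - y by exists (x - y).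
rewrite -hw => hq.
pose Q : 'M_n := 1%:M - (2 / bil g w w) *: (w *m (w^T *m g)).
have hQ u : Q *m u = u - (2 * bil g w u / bil g w w) *: w.
  rewrite mulmxBl mul1mx -scalemxAl -mulmxA [_ *m u]mx11_scalar -/(bil g w u).
  by rewrite mul_mx_scalar scalerA mulrAC.
exists Q; split.
  apply: bil_ext => u v; rewrite bil_frame !hQ -!scaleNr !(bilD1, bilD2, bilZ1, bilZ2).
  by rewrite (bil_sym u w) //; field.
rewrite hQ; have -> : 2 * bil g w y = - bil g w w.
  by rewrite hw -!scaleN1r !(bilD1, bilD2, bilZ1, bilZ2) (bil_sym y x) // hxy; ring.
by rewrite mulNr divff // scaleN1r opprK hw addrC subrK.
Qed.
End BilinearForms.

(** * Change of frame, and superenergy tensors as negated squares up to trace *)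

Section Frames.
Variable R : realType.
Implicit Types (g T M P A : 'M[R]_5) (u v w : 'cV[R]_5).

Notation eta := (minkowski5 R).

Lemma etaE u v : bil eta u v = - u o0 0 * v o0 0 + u o1 0 * v o1 0
  + u o2 0 * v o2 0 + u o3 0 * v o3 0 + u o4 0 * v o4 0.
Proof. by rewrite bilE !sum5 !mxE /=; ring. Qed.

Lemma eta_sqr : eta *m eta = 1%:M.
Proof. by apply/matrixP; do 2![apply: forall5]; rewrite !mxE sum5 !mxE /=; ring. Qed.
Lemma eta_tr : eta^T = eta.
Proof. by apply/matrixP; do 2![apply: forall5]; rewrite !mxE /=. Qed.
Lemma eta_unit : eta \in unitmx.
Proof. by case/mulmx1_unit: eta_sqr. Qed.
Lemma eta_inv : invmx eta = eta.
Proof. by apply: (can_inj (mulKmx eta_unit)); rewrite mulmxV ?eta_unit ?eta_sqr. Qed.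

Definition in_frame P T := invmx P *m T *m P.

Lemma in_frame_lower g P T : P \in unitmx ->
  (P^T *m g *m P) *m in_frame P T = P^T *m (g *m T) *m P.
Proof. by move=> hP; rewrite /in_frame !mulmxA mulmxK. Qed.

Lemma in_frameM P T1 T2 : P \in unitmx -> in_frame P (T1 *m T2) = in_frame P T1 *m in_frame P T2.
Proof. by move=> hP; rewrite /in_frame !mulmxA mulmxK. Qed.
Lemma in_frameD P T1 T2 : in_frame P (T1 + T2) = in_frame P T1 + in_frame P T2.
Proof. by rewrite /in_frame mulmxDr mulmxDl. Qed.
Lemma in_frameN P T : in_frame P (- T) = - in_frame P T.
Proof. by rewrite /in_frame mulmxN mulNmx. Qed.
Lemma in_frame_scalar P a : P \in unitmx -> in_frame P a%:M = a%:M.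
Proof. by move=> hP; rewrite /in_frame mul_mx_scalar -scalemxAl mulVmx // scalemx1. Qed.
Lemma in_frame_tr P T : P \in unitmx -> \tr (in_frame P T) = \tr T.
Proof. by move=> hP; rewrite /in_frame mxtrace_mulC mulmxA mulmxV // mul1mx. Qed.
Lemma in_frameK P T : P \in unitmx -> in_frame (invmx P) (in_frame P T) = T.
Proof. by move=> hP; rewrite /in_frame invmxK !mulmxA mulmxV // mul1mx mulmxK. Qed.
Lemma in_frame_eq0 P T : P \in unitmx -> in_frame P T = 0 -> T = 0.
Proof. by move=> hP h; rewrite -[T](in_frameK _ hP) h /in_frame mulmx0 mul0mx. Qed.

Lemma g_symmetric_frame g P T : P \in unitmx -> g_symmetric g T ->
  g_symmetric (P^T *m g *m P) (in_frame P T).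
Proof.
move=> hP h; rewrite /g_symmetric in_frame_lower // !trmx_mul trmxK.
by rewrite -(h : _ = _) trmx_mul !mulmxA.
Qed.

Lemma condition_b_frame P T : P \in unitmx -> condition_b T <-> condition_b (in_frame P T).
Proof.
move=> hP; rewrite /condition_b.
set X := (X in X = 0 <-> _); set Y := (Y in _ <-> Y = 0).
have -> : Y = in_frame P X.
  rewrite /X /Y in_frameM // !(in_frameD, in_frameN) in_frameM // !in_frame_scalar //.
  by rewrite -in_frameM // !in_frame_tr.
by split=> [->|]; [rewrite /in_frame mulmx0 mul0mx | exact: in_frame_eq0].
Qed.

Lemma invmxM n (A B : 'M[R]_n) : A \in unitmx -> B \in unitmx ->
  invmx (A *m B) = invmx B *m invmx A.
Proof.
move=> hA hB; have hAB : A *m B \in unitmx by rewrite unitmx_mul hA.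
by apply: (can_inj (mulKmx hAB)); rewrite mulmxV // mulmxA mulmxK // mulmxV.
Qed.

(** Metric and 2-form change by congruence; raising one index turns this into conjugation, which
    preserves the trace term. *)
Lemma superenergy_in_frame g P F : P \in unitmx -> g \in unitmx ->
  superenergy_of (P^T *m g *m P) (P^T *m F *m P) = in_frame P (superenergy_of g F).
Proof.
move=> hP hg; have hPt : P^T \in unitmx by rewrite unitmx_tr.
have hX : raise2 (P^T *m g *m P) (P^T *m F *m P) *m (P^T *m F *m P)^T
   = in_frame P (raise2 g F *m F^T).
  rewrite /raise2 /in_frame !invmxM ?unitmx_mul ?hPt ?hg // !trmx_mul !trmxK !trmx_inv !trmxK.
  by rewrite !mulmxA !mulmxKV // mulmxK.
by rewrite /superenergy_of hX in_frameD in_frameN in_frame_scalar // in_frame_tr.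
Qed.

Lemma is_superenergy_frame g P T : P \in unitmx -> g \in unitmx ->
  is_superenergy g T <-> is_superenergy (P^T *m g *m P) (in_frame P T).
Proof.
move=> hP hg; split=> [[F [hF ->]]|[F [hF hT]]].
  exists (P^T *m F *m P); split; last by rewrite superenergy_in_frame.
  by rewrite /two_form !trmx_mul trmxK hF mulNmx mulmxN mulmxA.
exists ((invmx P)^T *m F *m invmx P); split.
  by rewrite /two_form !trmx_mul trmxK hF mulNmx mulmxN mulmxA.
have hF' : F = P^T *m ((invmx P)^T *m F *m invmx P) *m P.
  by rewrite trmx_inv !mulmxA mulmxKV // mulmxV ?unitmx_tr // mul1mx.
by rewrite -[T](in_frameK T hP) hT {1}hF' superenergy_in_frame // in_frameK.
Qed.

(* [A] is [F] with its first index raised, [A^a_b = F^a_b]; then [T - [T] = - A^2]. *)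
Definition minus_square T :=
  exists A, (eta *m A)^T = - (eta *m A) /\ T - (\tr T)%:M = - (A *m A).

(** For [X = F^{ac} F_{bc}], dimension 5 gives [[T] = [X] - 5/4 [X] = - [X] / 4]. Hence [T - [T] =
    X], and [X = - A^2] with [A = eta F]; conversely [F = eta A]. *)
Lemma is_superenergy_eta T : is_superenergy eta T <-> minus_square T.
Proof.
have hr F : two_form F -> raise2 eta F *m F^T = - ((eta *m F) *m (eta *m F)).
  by move=> hF; rewrite /raise2 eta_inv eta_tr hF mulmxN !mulmxA.
have tr5 (a : R) : \tr (a%:M : 'M_5) = a * 5 by rewrite mxtrace_scalar mulr_natr.
split=> [[F [hF ->]]|[A [hA hT]]].
  exists (eta *m F); rewrite mulmxA eta_sqr mul1mx; split=> //.
  rewrite /superenergy_of hr //; move: (- _) => X.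
  rewrite mxtraceD [\tr (- _)]raddfN /= tr5.
  have -> : \tr X - 4^-1 * \tr X * 5 = - (4^-1 * \tr X) by lra.
  by rewrite [(- _)%:M]raddfN /= opprK subrK.
exists (eta *m A); split=> //.
rewrite /superenergy_of hr // [eta *m (eta *m A)]mulmxA eta_sqr mul1mx -hT.
rewrite mxtraceD [\tr (- _)]raddfN /= tr5.
have -> : 4^-1 * (\tr T - \tr T * 5) = - \tr T by lra.
by rewrite [(- _)%:M]raddfN /= opprK subrK.
Qed.
End Frames.

(** * The future cone *)

Section Cone.
Variable R : realType.
Implicit Types (g T M P A : 'M[R]_5) (u v w : 'cV[R]_5).
Notation eta := (minkowski5 R).

(** Lagrange's identity: the difference of the two sides is the sum of the squares of the 2x2
    minors. *)
Lemma CauchySchwarz4 (x1 x2 x3 x4 y1 y2 y3 y4 : R) :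
  (x1 * y1 + x2 * y2 + x3 * y3 + x4 * y4) ^+ 2
  <= (x1 ^+ 2 + x2 ^+ 2 + x3 ^+ 2 + x4 ^+ 2) * (y1 ^+ 2 + y2 ^+ 2 + y3 ^+ 2 + y4 ^+ 2).
Proof.
rewrite -subr_ge0.
have -> : (x1 ^+ 2 + x2 ^+ 2 + x3 ^+ 2 + x4 ^+ 2) * (y1 ^+ 2 + y2 ^+ 2 + y3 ^+ 2 + y4 ^+ 2)
  - (x1 * y1 + x2 * y2 + x3 * y3 + x4 * y4) ^+ 2
  = (x1 * y2 - x2 * y1) ^+ 2 + (x1 * y3 - x3 * y1) ^+ 2 + (x1 * y4 - x4 * y1) ^+ 2
  + (x2 * y3 - x3 * y2) ^+ 2 + (x2 * y4 - x4 * y2) ^+ 2 + (x3 * y4 - x4 * y3) ^+ 2 by ring.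
by rewrite !addr_ge0 ?sqr_ge0.
Qed.

(** The closed future cone with its apex, so that sums, nonnegative multiples and limits stay
    inside. *)
Definition cone u : Prop := 0 <= u o0 0 /\ bil eta u u <= 0.

Definition spatial_sqr u : R := u o1 0 ^+ 2 + u o2 0 ^+ 2 + u o3 0 ^+ 2 + u o4 0 ^+ 2.
Lemma spatial_sqr_ge0 u : 0 <= spatial_sqr u.
Proof. by rewrite !addr_ge0 ?sqr_ge0. Qed.
Lemma eta_diagE u : bil eta u u = spatial_sqr u - u o0 0 ^+ 2.
Proof. by rewrite etaE /spatial_sqr; ring. Qed.
Lemma eta_CauchySchwarz u v : (bil eta u v + u o0 0 * v o0 0) ^+ 2 <= spatial_sqr u * spatial_sqr v.
Proof.
have -> : bil eta u v + u o0 0 * v o0 0 = u o1 0 * v o1 0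
  + u o2 0 * v o2 0 + u o3 0 * v o3 0 + u o4 0 * v o4 0 by rewrite etaE; ring.
exact: CauchySchwarz4.
Qed.

(** By Cauchy-Schwarz the spatial inner product is at most the product of the spatial norms, hence
    at most [u0 v0]. *)
Lemma cone_dot u v : cone u -> cone v -> bil eta u v <= 0.
Proof.
move=> [u0 hu] [v0 hv]; rewrite leNgt; apply/negP => huv.
rewrite !eta_diagE !subr_le0 in hu hv.
have := eta_CauchySchwarz u v; rewrite leNgt => /negP; apply.
apply: le_lt_trans (ler_pM (spatial_sqr_ge0 u) (spatial_sqr_ge0 v) hu hv) _.
rewrite -exprMn ltr_sqr ?nnegrE ?mulr_ge0 //; first by rewrite ltrDr.
by rewrite addr_ge0 ?mulr_ge0 // ltW.
Qed.

Lemma cone_eq0 u : cone u -> u o0 0 = 0 -> u = 0.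
Proof.
move=> [_]; rewrite eta_diagE => hu u0; rewrite u0 expr0n subr0 in hu.
have := sqr_ge0 (u o1 0); have := sqr_ge0 (u o2 0).
have := sqr_ge0 (u o3 0); have := sqr_ge0 (u o4 0); rewrite /spatial_sqr in hu.
move=> h4 h3 h2 h1; apply/colP; apply: forall5; rewrite mxE //.
- by apply/eqP; rewrite -sqrf_eq0; apply/eqP; lra.
- by apply/eqP; rewrite -sqrf_eq0; apply/eqP; lra.
- by apply/eqP; rewrite -sqrf_eq0; apply/eqP; lra.
- by apply/eqP; rewrite -sqrf_eq0; apply/eqP; lra.
Qed.

Lemma cone_gt0 u : cone u -> u != 0 -> 0 < u o0 0.
Proof.
move=> hu; apply: contraNT; rewrite lt_def negb_and negbK (proj1 hu) orbF.
by move=> /eqP /(cone_eq0 hu) ->.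
Qed.

Lemma cone_dot_lt u v : cone u -> bil eta u u < 0 -> cone v -> v != 0 -> bil eta u v < 0.
Proof.
move=> hu huu hv vn0; rewrite lt_def cone_dot // andbT; apply/eqP => huv.
have := eta_CauchySchwarz u v; rewrite -huv add0r exprMn leNgt => /negP; apply.
have v0 : 0 < v o0 0 ^+ 2 by rewrite exprn_gt0 // cone_gt0.
case: hv => _; move: huu; rewrite !eta_diagE subr_lt0 subr_le0 => hu' hv'.
apply: le_lt_trans (ler_wpM2l (spatial_sqr_ge0 u) hv') _.
by rewrite ltr_pM2r.
Qed.

Lemma coneD u v : cone u -> cone v -> cone (u + v).
Proof.
move=> hu hv; have := cone_dot hu hv; have := cone_dot hv hu.
case: hu hv => u0 hu [v0 hv] h1 h2; split; first by rewrite mxE addr_ge0.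
by rewrite !(bilD1, bilD2); lra.
Qed.

Lemma coneZ a u : 0 <= a -> cone u -> cone (a *: u).
Proof.
move=> a0 [u0 hu]; split; first by rewrite mxE mulr_ge0.
by rewrite bilZ1 bilZ2 mulrA -expr2 mulr_ge0_le0 ?sqr_ge0.
Qed.

Lemma cone0 : cone 0.
Proof. by split; rewrite ?mxE // -(scale0r 0) bilZ1 mul0r. Qed.

Lemma coneN u : bil eta u u <= 0 -> u o0 0 <= 0 -> cone (- u).
Proof. by move=> hu u0; split; rewrite ?mxE ?oppr_ge0 // bilN1 bilN2 opprK. Qed.

Definition e0 : 'cV[R]_5 := delta_mx o0 0.
Lemma e0E i : e0 i 0 = (i == o0)%:R.
Proof. by rewrite mxE andbT. Qed.
Lemma eta_e0 v : bil eta e0 v = - v o0 0.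
Proof. by rewrite etaE !e0E /=; ring. Qed.
Lemma eta_e00 : bil eta e0 e0 = -1.
Proof. by rewrite eta_e0 e0E. Qed.
Lemma e0_neq0 : e0 != 0.
Proof. by apply/eqP => /colP /(_ o0); rewrite e0E mxE /= => /eqP; rewrite oner_eq0. Qed.
Lemma cone_e0 : cone e0.
Proof. by split; rewrite ?eta_e00 ?e0E //= lerN10. Qed.

(** Half of the self-duality of the cone. Two test vectors suffice: [e0], and the null vector with
    the spatial part of [y]. *)
Lemma cone_dual y : (forall v, cone v -> bil eta y v <= 0) -> cone y.
Proof.
move=> hy.
have y0 : 0 <= y o0 0.
  by have := hy _ cone_e0; rewrite bil_sym ?eta_tr // eta_e0 oppr_le0.
split=> //; rewrite eta_diagE subr_le0 leNgt; apply/negP => hlt.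
pose s := Num.sqrt (spatial_sqr y).
have s2 : s ^+ 2 = spatial_sqr y by rewrite sqr_sqrtr ?spatial_sqr_ge0.
have s0 : 0 <= s by exact: sqrtr_ge0.
(* This replaces the time component of [y] by its spatial norm [s]. The product with [y] is then
   [s (s - y0)], which is positive if [y0 < s]. *)
pose v := y + (s - y o0 0) *: e0.
have v0 : v o0 0 = s by rewrite !mxE /=; ring.
have v2 : spatial_sqr v = spatial_sqr y by rewrite /spatial_sqr !mxE /= !mulr0 !addr0.
have /hy : cone v by split; rewrite ?v0 // eta_diagE v2 v0 s2 subrr.
rewrite /v bilD2 bilZ2 [bil eta y e0]bil_sym ?eta_tr // eta_e0 eta_diagE -s2.
have lt : y o0 0 < s by rewrite -ltr_sqr ?nnegrE // s2.
nra.
Qed.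

Definition cone_dominant T := forall u v, cone u -> cone v -> 0 <= bil (eta *m T) u v.

Lemma future_causal_frame g P (tau' u : 'cV_5) : P \in unitmx -> P^T *m g *m P = eta ->
  cone tau' -> bil eta tau' tau' < 0 ->
  future_causal g (P *m tau') (P *m u) <-> cone u /\ u != 0.
Proof.
move=> hP hg ht htt; rewrite /future_causal /causal.
have hb x y : gdot g (P *m x) (P *m y) = bil eta x y by rewrite -hg bil_frame.
rewrite !hb; have -> : (P *m u != 0) = (u != 0).
  congr (~~ _); apply/eqP/eqP => [h|->]; last by rewrite mulmx0.
  by rewrite -(mulKmx hP u) h mulmx0.
split=> [[[-> hu] hut]|[hu un0]].
  split=> //; split=> //; rewrite leNgt; apply/negP => u0.
  have := cone_dot (coneN hu (ltW u0)) ht; rewrite bilN1 oppr_le0 leNgt.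
  by rewrite hut.
by split; [case: hu | rewrite bil_sym ?eta_tr // cone_dot_lt].
Qed.

Lemma dominant_energy_frame g P T (tau' : 'cV_5) : P \in unitmx -> P^T *m g *m P = eta ->
  cone tau' -> bil eta tau' tau' < 0 ->
  dominant_energy g (P *m tau') T <-> cone_dominant (in_frame P T).
Proof.
move=> hP hg ht htt.
have hb x y : bil (eta *m in_frame P T) x y = bil (g *m T) (P *m x) (P *m y).
  by rewrite -hg in_frame_lower // bil_frame.
split=> [hD u v hu hv|hD u v].
  rewrite hb; have [->|un0] := eqVneq u 0; first by rewrite mulmx0 -(scale0r 0) bilZ1 mul0r.
  have [->|vn0] := eqVneq v 0; first by rewrite mulmx0 -(scale0r 0) bilZ2 mul0r.
  by apply: hD; apply/(future_causal_frame _ hP hg ht htt).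
rewrite -(mulKVmx hP u) -(mulKVmx hP v).
move=> /(future_causal_frame _ hP hg ht htt) [hu _].
move=> /(future_causal_frame _ hP hg ht htt) [hv _].
by have := hD _ _ hu hv; rewrite hb.
Qed.

(** Both [P] and [- P] are orthonormal frames; the sign is chosen so that the given time orientation
    becomes the standard one. *)
Lemma lorentz_frame_ex g tau : lorentz_metric g -> timelike g tau ->
  exists P (tau' : 'cV_5), [/\ P \in unitmx, P^T *m g *m P = eta, tau = P *m tau',
    cone tau' & bil eta tau' tau' < 0].
Proof.
move=> [P [hP hg]] htau; pose t := invmx P *m tau.
have htP : P *m t = tau by rewrite mulKVmx.
have ht : bil eta t t < 0 by rewrite -hg bil_frame htP.
have [t0|t0] := lerP 0 (t o0 0); first by exists P, t; split=> //; split=> //; exact: ltW.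
exists (- P), (- t); split.
- by rewrite -scaleN1r unitmxZ ?unitrN1.
- by rewrite [(- P)^T]linearN /= mulmxN !mulNmx opprK.
- by rewrite mulmxN mulNmx opprK htP.
- by apply: coneN; exact: ltW.
- by rewrite bilN1 bilN2 opprK.
Qed.

Definition lorentz P := P^T *m eta *m P = eta.

Lemma lorentz_unit P : lorentz P -> P \in unitmx.
Proof.
rewrite /lorentz => h; have : eta *m (P^T *m eta *m P) = 1%:M by rewrite h eta_sqr.
by rewrite mulmxA => /mulmx1_unit [].
Qed.

Lemma lorentz_bil P u v : lorentz P -> bil eta (P *m u) (P *m v) = bil eta u v.
Proof. by move=> h; rewrite -bil_frame h. Qed.

(** If [P u] pointed to the past, then pairing [- P u] with [P e0] inside the cone would give
    [u0 <= 0], hence [u = 0]. *)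
Lemma cone_lorentz P u : lorentz P -> cone (P *m e0) -> cone u -> cone (P *m u).
Proof.
move=> hP hPe hu; have hPu : bil eta (P *m u) (P *m u) <= 0.
  by rewrite lorentz_bil //; case: hu.
have [h0|h0] := lerP 0 ((P *m u) o0 0); first by split.
have := cone_dot hPe (coneN hPu (ltW h0)).
rewrite bilN2 lorentz_bil // eta_e0 opprK => hu0.
have u0 : u o0 0 = 0 by apply/eqP; rewrite eq_le hu0; case: hu => ->.
by rewrite (cone_eq0 hu u0) mulmx0; exact: cone0.
Qed.

Lemma cone_dominant_lorentz P T : lorentz P -> cone (P *m e0) -> cone_dominant T ->
  cone_dominant (in_frame P T).
Proof.
move=> hP hPe hT u v hu hv.
rewrite -{1}(hP : _ = _) in_frame_lower ?lorentz_unit // bil_frame.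
by apply: hT; apply: cone_lorentz.
Qed.

Lemma minus_square_lorentz P T : lorentz P -> minus_square (in_frame P T) -> minus_square T.
Proof.
move=> hP; have hu := lorentz_unit hP.
by rewrite -!is_superenergy_eta -{1}(hP : _ = _) -is_superenergy_frame // eta_unit.
Qed.

Lemma g_symmetric_lorentz P T : lorentz P -> g_symmetric eta T -> g_symmetric eta (in_frame P T).
Proof.
move=> hP hT; rewrite -[X in g_symmetric X](hP : _ = _).
by apply: g_symmetric_frame => //; exact: lorentz_unit.
Qed.

End Cone.

Arguments e0 {R}.

(** * Existence of a causal eigenvector *)

Section CausalEigenvector.
Variable R : realType.
Implicit Types (g T M P A : 'M[R]_5) (u v w : 'cV[R]_5).
Notation eta := (minkowski5 R).

Lemma comm_mx_shift n (X Y : 'M[R]_n) a b :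
  comm_mx X Y -> comm_mx (X - a%:M) (Y - b%:M).
Proof.
move=> hXY; apply: comm_mxB; last exact: comm_mx_scalar.
by apply/comm_mx_sym/comm_mxB; [exact: comm_mx_sym | exact: comm_mx_scalar].
Qed.

Lemma condition_bE T (c := 4^-1 * \tr (T *m T) - 4^-1 * (\tr T) ^+ 2) :
  condition_b T <-> (T *m T - c%:M) *m (T - (\tr T)%:M) = 0.
Proof.
rewrite /condition_b; set X := (X in X *m _ = 0 <-> _).
by have -> : X = T *m T - c%:M by rewrite /X /c [(_ - _)%:M]raddfB /= opprB addrA addrAC.
Qed.

(** A closed cone contains its recession directions: divide [u + m w] by [m] and let [m] grow. The
    limit is replaced by Archimedean bounds. *)
Lemma cone_recession u w : (forall n : nat, exists2 m : R, n%:R <= m & cone (u + m *: w)) -> cone w.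
Proof.
move=> h; split.
  rewrite leNgt; apply/negP => w0.
  have [m hm [+ _]] := h (Num.bound `|u o0 0 / - w o0 0|); rewrite !mxE.
  have hlt : u o0 0 / - w o0 0 < m.
    by apply: lt_le_trans hm; apply: le_lt_trans (ler_norm _) (archi_boundP (normr_ge0 _)).
  by move: hlt; rewrite ltr_pdivrMr ?oppr_gt0 // mulrN => hlt; lra.
rewrite leNgt; apply/negP => w0.
(* For [m >= 1] the norm of [u + m w] is at least [m (m g(w,w) - q0)]. *)
pose q0 := `|bil eta u u| + 2 * `|bil eta u w|.
have q00 : 0 <= q0 by rewrite addr_ge0 ?mulr_ge0.
have [m hm [_ +]] := h (Num.bound (q0 / bil eta w w)).+1.
have hb := archi_boundP (divr_ge0 q00 (ltW w0)).
have m1 : 1 <= m by apply: le_trans hm; rewrite ler1n.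
have hlt : q0 < m * bil eta w w.
  rewrite -ltr_pdivrMr //; apply: lt_le_trans hb (le_trans _ hm).
  by rewrite ler_nat.
rewrite !(bilD1, bilD2, bilZ1, bilZ2) (bil_sym w u) ?eta_tr // leNgt => /negP; apply.
have h1 := ler_norm (- bil eta u u); have h2 := ler_norm (- bil eta u w).
rewrite !normrN in h1 h2.
have h3 : 0 <= `|bil eta u u| by [].
have h4 : m * q0 < m * (m * bil eta w w) by rewrite ltr_pM2l //; lra.
have h5 : `|bil eta u u| <= m * `|bil eta u u| by rewrite ler_peMl.
have h6 : m * - bil eta u w <= m * `|bil eta u w| by rewrite ler_pM2l //; lra.
rewrite /q0 in h4; rewrite mulrDr in h4; lra.
Qed.

(* Perron-Frobenius for the light cone. For [c <= d] the vector [w := X u - c u] is an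
   eigenvector for [d]; when [c > 0] it is the direction of [X^n u] for large [n]. *)
Lemma cone_eigenvector_le (X : 'M[R]_5) u c d : c <= d ->
  (forall v, cone v -> cone (X *m v)) -> cone u -> u != 0 ->
  X *m (X *m u - c *: u) = d *: (X *m u - c *: u) ->
  exists w r, [/\ cone w, w != 0 & X *m w = r *: w].
Proof.
move=> cd hX hu un0; set w := X *m u - c *: u => hw.
have hXu : X *m u = c *: u + w by rewrite /w addrC subrK.
have [w0|wn0] := eqVneq w 0; first by exists u, c; rewrite hXu w0 addr0.
exists w, d; split=> //.
have [c0|c0] := lerP c 0.
  by rewrite /w -scaleNr; apply: coneD; [exact: hX | apply: coneZ; rewrite ?oppr_ge0].
have hc : c != 0 by rewrite gt_eqF.
apply: (@cone_recession (c *: u)) => n.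
suff [m [hm _ hcm]] : exists m, [/\ n%:R <= m, 0 <= m & cone (c *: u + m *: w)] by exists m.
elim: n => [|n [m [hm m0 hcm]]].
  by exists 0; rewrite scale0r addr0; split=> //; apply: coneZ => //; exact: ltW.
(* Applying [X] and dividing by [c] maps [c u + m w] to [c u + (1 + m d / c) w]. As [d >= c], the
   coefficient grows by at least 1. *)
exists (1 + m * d / c); have hle : m <= m * d / c by rewrite -mulrA ler_peMr // ler_pdivlMr ?mul1r.
split; first by rewrite -natr1; lra.
  by lra.
have := coneZ (_ : 0 <= c^-1) (hX _ hcm); rewrite invr_ge0 ltW // => /(_ isT).
have -> // : c^-1 *: (X *m (c *: u + m *: w)) = c *: u + (1 + m * d / c) *: w.
rewrite mulmxDr -!scalemxAr hXu hw scalerDr scalerA mulVf // scale1r -addrA; congr (_ + _).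
by rewrite !scalerA -{1}[w]scale1r -scalerDl -mulrA [c^-1 * _]mulrC.
Qed.

(** The dominant energy condition says that [- T u] has nonpositive product with every vector of the
    cone, so self-duality applies. *)
Lemma cone_map T u : g_symmetric eta T -> cone_dominant T -> cone u -> cone (- (T *m u)).
Proof.
move=> hs hT hu; apply: cone_dual => v hv.
by rewrite bilN1 oppr_le0 bilM1 -{1}eta_tr -trmx_mul hs; apply: hT.
Qed.

(** The power iteration is run with [X = T^2], which preserves the cone and has a quadratic
    annihilating polynomial; an eigenvector of [T] is then extracted from one of [T^2]. *)
Lemma causal_eigenvector T : g_symmetric eta T -> cone_dominant T -> condition_b T ->
  exists k r, [/\ cone k, k != 0 & T *m k = r *: k].
Proof.
move=> hs hT /condition_bE; set c := 4^-1 * _ - _; set t := \tr T => hb.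
have hC2 v : cone v -> cone (T *m T *m v).
  move=> hv; have -> : T *m T *m v = - (T *m - (T *m v)) by rewrite mulmxN opprK mulmxA.
  by do 2![apply: cone_map => //].
(* Condition (b) multiplied by [T + t] becomes a polynomial equation in [T^2]. *)
have hquart : (T *m T - c%:M) *m (T *m T - (t ^+ 2)%:M) = 0.
  have -> : T *m T - (t ^+ 2)%:M = (T - t%:M) *m (T + t%:M).
    by rewrite mulmxBl !mulmxDr scalar_mxC -scalar_mxM expr2 opprD addrA addrK.
  by rewrite mulmxA hb mul0mx.
have hquart' : (T *m T - (t ^+ 2)%:M) *m (T *m T - c%:M) = 0.
  by rewrite -[RHS]hquart; apply: comm_mx_shift.
have heig (a b : R) : (T *m T - b%:M) *m (T *m T - a%:M) = 0 ->
    T *m T *m (T *m T *m e0 - a *: e0) = b *: (T *m T *m e0 - a *: e0).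
  move=> h; apply/eqP; rewrite -subr_eq0 -!mul_scalar_mx -mulmxBl -mulmxBl mulmxA h.
  by rewrite mul0mx.
have [w [r [hw wn0 hTw]]] : exists w r, [/\ cone w, w != 0 & T *m T *m w = r *: w].
  have [cd|cd] := lerP c (t ^+ 2).
    by exact: (cone_eigenvector_le cd hC2 (cone_e0 R) (e0_neq0 R) (heig _ _ hquart')).
  by exact: (cone_eigenvector_le (ltW cd) hC2 (cone_e0 R) (e0_neq0 R) (heig _ _ hquart)).
have w0 := cone_gt0 hw wn0.
have r0 : 0 <= r.
  by have [+ _] := hC2 _ hw; rewrite hTw mxE pmulr_lge0.
have hy := cone_map hs hT hw; set y := - _ in hy.
pose b := Num.sqrt r; have b2 : b * b = r by rewrite -expr2 sqr_sqrtr.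
have b0 : 0 <= b by exact: sqrtr_ge0.
have hv := coneD hy (coneZ b0 hw).
(* With [b^2 = r], the vector [y + b w = - (T - b) w] is annihilated by [T + b]. If it vanishes,
   both future-pointing summands have zero time component, so [y = 0] and [T w = 0]. *)
have [v0|vn0] := eqVneq (y + b *: w) 0; last first.
  exists (y + b *: w), (- b); split=> //.
  rewrite mulmxDr mulmxN mulmxA hTw -scalemxAr -[T *m w]opprK -/y -b2 scaleNr scalerDr.
  by rewrite scalerN opprD addrC scalerA.
have y0 : y o0 0 = 0.
  have := congr1 (fun x : 'cV_5 => x o0 0) v0; case: hy => + _; clearbody y; rewrite !mxE.
  have : 0 <= b * w o0 0 by rewrite mulr_ge0 // ltW.
  lra.
exists w, 0; split=> //; rewrite scale0r -[T *m w]opprK -/y.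
by rewrite (cone_eq0 hy y0) oppr0.
Qed.

End CausalEigenvector.

(** * Superenergy tensors satisfy (a) and (b) *)

Section Superenergy.
Variable R : realType.
Implicit Types (g T M P A : 'M[R]_5) (u v w : 'cV[R]_5).
Notation eta := (minkowski5 R).

Definition mx5 (s : seq (seq R)) : 'M[R]_5 := \matrix_(i, j) nth 0 (nth [::] s i) j.

Lemma eta_mulE A i j : (eta *m A) i j = if i == o0 then - A i j else A i j.
Proof. by rewrite mxE sum5 !mxE; move: i; apply: forall5 => /=; ring. Qed.

(* [e] and [b] are the electric and magnetic parts of the 2-form. *)
Definition so14 (e1 e2 e3 e4 b12 b13 b14 b23 b24 b34 : R) := mx5
  [:: [::  0;   e1;    e2;    e3;   e4];
      [:: e1;    0;   b12;   b13;  b14];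
      [:: e2; - b12;    0;   b23;  b24];
      [:: e3; - b13; - b23;    0;  b34];
      [:: e4; - b14; - b24; - b34;   0]].

Lemma so14P A : (eta *m A)^T = - (eta *m A) <->
  exists e1 e2 e3 e4 b12 b13 b14 b23 b24 b34, A = so14 e1 e2 e3 e4 b12 b13 b14 b23 b24 b34.
Proof.
split=> [h|[e1 [e2 [e3 [e4 [b12 [b13 [b14 [b23 [b24 [b34 ->]]]]]]]]]]]; last first.
  by apply/matrixP; do 2![apply: forall5]; rewrite mxE [RHS]mxE !eta_mulE !mxE /= ?opprK ?oppr0.
have hE i j : (if j == o0 then - A j i else A j i) = - (if i == o0 then - A i j else A i j).
  by move/matrixP/(_ i j): h; rewrite mxE [in RHS]mxE !eta_mulE.
exists (A o0 o1), (A o0 o2), (A o0 o3), (A o0 o4).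
exists (A o1 o2), (A o1 o3), (A o1 o4), (A o2 o3), (A o2 o4), (A o3 o4).
apply/matrixP.
have hd i : A i i = 0 by have := hE i i; case: ifP => _; lra.
have h0 i : i != o0 -> A i o0 = A o0 i by move=> /negPf hi; have := hE i o0; rewrite hi /=; lra.
have hn i j : i != o0 -> j != o0 -> A j i = - A i j.
  by move=> /negPf hi /negPf hj; have := hE i j; rewrite hi hj.
by do 2![apply: forall5]; rewrite mxE /= ?hd ?[A _ o0]h0 //; apply: hn.
Qed.

Lemma minus_square_tr A T : T - (\tr T)%:M = - (A *m A) -> \tr T = 4^-1 * \tr (A *m A).
Proof.
move=> /(congr1 (@mxtrace _ _)); rewrite mxtraceD [\tr (- _)]raddfN /= mxtrace_scalar.
by rewrite [\tr (- _)]raddfN /= -mulr_natr; lra.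
Qed.

(** The energy density is [(E + B) / 2]. Two Cauchy-Schwarz estimates bound the square of the flux
    term by [E B v0^2], and the arithmetic-geometric mean inequality concludes. *)
Lemma minus_square_dec_e0 T v : minus_square T -> cone v -> 0 <= bil (eta *m T) e0 v.
Proof.
case=> A [/so14P [e1 [e2 [e3 [e4 [b12 [b13 [b14 [b23 [b24 [b34 hA]]]]]]]]]] hT] [v0 hv].
have htr := minus_square_tr hT.
have hT' : T = - (A *m A) + (\tr T)%:M by rewrite -hT subrK.
pose w1 := b12 * v o2 0 + b13 * v o3 0 + b14 * v o4 0.
pose w2 := - b12 * v o1 0 + b23 * v o3 0 + b24 * v o4 0.
pose w3 := - b13 * v o1 0 - b23 * v o2 0 + b34 * v o4 0.
pose w4 := - b14 * v o1 0 - b24 * v o2 0 - b34 * v o3 0.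
pose E := e1 ^+ 2 + e2 ^+ 2 + e3 ^+ 2 + e4 ^+ 2.
pose B := b12 ^+ 2 + b13 ^+ 2 + b14 ^+ 2 + b23 ^+ 2 + b24 ^+ 2 + b34 ^+ 2.
have -> : bil (eta *m T) e0 v = v o0 0 * ((E + B) / 2)
     + (e1 * w1 + e2 * w2 + e3 * w3 + e4 * w4).
  rewrite -bilM2 eta_e0 hT' htr mulmxDl mulNmx mul_scalar_mx -mulmxA.
  have -> : \tr (A *m A) = 2 * E - 2 * B.
    by rewrite /mxtrace sum5 !mxE !sum5 hA !mxE /= /E /B; ring.
  rewrite 2!mxE [X in - X + _]mxE [X in _ + X]mxE sum5 !mxE !sum5 hA !mxE /=.
  by rewrite /w1 /w2 /w3 /w4 /E /B; field.
have E0 : 0 <= E by rewrite !addr_ge0 ?sqr_ge0.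
have B0 : 0 <= B by rewrite !addr_ge0 ?sqr_ge0.
(* [|y|^2 |B|^2 - |B y|^2] is the squared norm of the 3-form [y /\ B]. *)
have hw : w1 ^+ 2 + w2 ^+ 2 + w3 ^+ 2 + w4 ^+ 2 <= B * v o0 0 ^+ 2.
  rewrite eta_diagE subr_le0 in hv; apply: le_trans (ler_wpM2l B0 hv).
  rewrite -subr_ge0 /spatial_sqr.
  have -> : B * (v o1 0 ^+ 2 + v o2 0 ^+ 2 + v o3 0 ^+ 2 + v o4 0 ^+ 2)
    - (w1 ^+ 2 + w2 ^+ 2 + w3 ^+ 2 + w4 ^+ 2)
    = (v o1 0 * b23 - v o2 0 * b13 + v o3 0 * b12) ^+ 2
    + (v o1 0 * b24 - v o2 0 * b14 + v o4 0 * b12) ^+ 2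
    + (v o1 0 * b34 - v o3 0 * b14 + v o4 0 * b13) ^+ 2
    + (v o2 0 * b34 - v o3 0 * b24 + v o4 0 * b23) ^+ 2 by rewrite /B /w1 /w2 /w3 /w4; ring.
  by rewrite !addr_ge0 ?sqr_ge0.
have h1 := le_trans (CauchySchwarz4 e1 e2 e3 e4 w1 w2 w3 w4) (ler_wpM2l E0 hw).
move: (_ + _ + _ + e4 * w4) h1 => x; move: (v o0 0) v0 => y y0 hx.
have hp : 0 <= y * ((E + B) / 2) by rewrite mulr_ge0 // divr_ge0 // addr_ge0.
rewrite leNgt; apply/negP => hlt.
have : x ^+ 2 <= (y * ((E + B) / 2)) ^+ 2.
  apply: le_trans hx _; rewrite -subr_ge0.
  have -> : (y * ((E + B) / 2)) ^+ 2 - E * (B * y ^+ 2) = (y * ((E - B) / 2)) ^+ 2 by field.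
  exact: sqr_ge0.
nra.
Qed.

(** Matrix product on entry functions, expanded over the five indices, so that iterated products
    unfold to explicit polynomials. *)
Definition mulf (f h : 'I_5 -> 'I_5 -> R) i j :=
  f i o0 * h o0 j + f i o1 * h o1 j + f i o2 * h o2 j + f i o3 * h o3 j + f i o4 * h o4 j.
Definition trf (f : 'I_5 -> 'I_5 -> R) := f o0 o0 + f o1 o1 + f o2 o2 + f o3 o3 + f o4 o4.

Lemma mulfE M N i j : (M *m N) i j = mulf M N i j.
Proof. by rewrite mxE sum5. Qed.

(* [eps^{abcde} F_bc F_de / 8], which spans the kernel of a generic [so14] matrix. *)
Definition pfaff (e1 e2 e3 e4 b12 b13 b14 b23 b24 b34 : R) : 'I_5 -> R :=
  fun i => nth 0 [:: b12 * b34 - b13 * b24 + b14 * b23;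
   e2 * b34 - e3 * b24 + e4 * b23; - e1 * b34 + e3 * b14 - e4 * b13;
   e1 * b24 - e2 * b14 + e4 * b12; - e1 * b23 + e2 * b13 - e3 * b12] i.

(** By Cayley-Hamilton the left side is the adjugate of [A]. The antisymmetric matrix [eta A] has
    adjugate [k k^T], where [k] collects its signed sub-Pfaffians; the sign on the right is
    [det eta]. The entries are checked as polynomial identities. *)
Lemma so14_quartic (e1 e2 e3 e4 b12 b13 b14 b23 b24 b34 : R)
  (A := so14 e1 e2 e3 e4 b12 b13 b14 b23 b24 b34) (X := A *m A)
  (k : 'cV_5 := \col_i pfaff e1 e2 e3 e4 b12 b13 b14 b23 b24 b34 i) :
  X *m X - (2^-1 * \tr X) *: X + (8^-1 * \tr X ^+ 2 - 4^-1 * \tr (X *m X))%:M = - (k *m k^T *m eta).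
Proof.
pose f (i j : 'I_5) := nth 0 (nth [::]
  [:: [::  0;   e1;    e2;    e3;   e4];
      [:: e1;    0;   b12;   b13;  b14];
      [:: e2; - b12;    0;   b23;  b24];
      [:: e3; - b13; - b23;    0;  b34];
      [:: e4; - b14; - b24; - b34;   0]] i) j.
have hA i j : A i j = f i j by rewrite mxE.
have hX i j : X i j = mulf f f i j by rewrite /X mulfE /mulf !hA.
have hX2 i j : (X *m X) i j = mulf (mulf f f) (mulf f f) i j by rewrite mulfE /mulf !hX.
have trX : \tr X = trf (mulf f f) by rewrite /mxtrace sum5 !hX.
have trX2 : \tr (X *m X) = trf (mulf (mulf f f) (mulf f f)) by rewrite /mxtrace sum5 !hX2.
have hk i j : (k *m k^T *m eta) i j = pfaff e1 e2 e3 e4 b12 b13 b14 b23 b24 b34 i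
    * pfaff e1 e2 e3 e4 b12 b13 b14 b23 b24 b34 j * (if j == o0 then -1 else 1).
  rewrite mulfE /mulf ![(k *m k^T) _ _]mxE !big_ord1 !mxE.
  by move: j; apply: forall5 => /=; ring.
apply/matrixP => i j.
rewrite [LHS]mxE [X in X + _ = _]mxE [X in _ + X + _ = _]mxE.
rewrite [X in _ - X + _ = _]mxE [X in _ + X = _]mxE.
rewrite [RHS]mxE hX2 hX hk trX trX2 {hA hX hX2 trX trX2 hk}.
rewrite /trf /mulf /f /pfaff.
move: i j; do 2![apply: forall5].
all: by simpl; field.
Qed.

Lemma scalar_mxB (a b : R) : (a - b)%:M = a%:M - b%:M :> 'M_5.
Proof. exact: raddfB. Qed.

Lemma sqr_scalar_sub (Y : 'M[R]_5) (t : R) :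
  (t%:M - Y) *m (t%:M - Y) = Y *m Y - (2 * t) *: Y + (t ^+ 2)%:M.
Proof.
rewrite mulmxBl !mulmxBr -scalar_mxM -expr2 mul_scalar_mx mul_mx_scalar.
move: (Y *m Y) => Y2; apply/matrixP => i j.
by rewrite !mxE; case: eqP => _; ring.
Qed.

(** Substituting [T = t - A^2] and [[A^2] = 4 t] turns [T^2 - c] into the quartic in [A], that is
    [- k k^T eta]. The other factor is [- A^2], and [k^T eta A = 0] because [A k = 0] and [eta A] is
    antisymmetric. *)
Lemma minus_square_condition_b T : minus_square T -> condition_b T.
Proof.
case=> A [hFA hT]; apply/condition_bE; have htr := minus_square_tr hT.
have hT' : T = (\tr T)%:M - A *m A by rewrite -hT addrC subrK.
have [e1 [e2 [e3 [e4 [b12 [b13 [b14 [b23 [b24 [b34 hA]]]]]]]]]] := (so14P A).1 hFA.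
have := so14_quartic e1 e2 e3 e4 b12 b13 b14 b23 b24 b34; rewrite -hA.
set k : 'cV_5 := \col_i _ => hCH; rewrite hT.
have hk : A *m k = 0.
  by apply/colP; apply: forall5; rewrite !mxE sum5 hA /k !mxE /pfaff /=; ring.
have hTT : T *m T = A *m A *m (A *m A) - (2 * \tr T) *: (A *m A) + (\tr T ^+ 2)%:M.
  by rewrite {1 2}hT' sqr_scalar_sub.
have htr2 : \tr (T *m T) = \tr (A *m A *m (A *m A)) - 3 * \tr T ^+ 2.
  by rewrite hTT !mxtraceD [\tr (- _)]raddfN /= mxtraceZ mxtrace_scalar -mulr_natr htr; field.
have -> : T *m T - (4^-1 * \tr (T *m T) - 4^-1 * \tr T ^+ 2)%:M = - (k *m k^T *m eta).
  rewrite -hCH htr2 hTT -addrA -scalar_mxB.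
  by congr (_ - _ *: _ + _%:M); rewrite htr;
    move: (\tr (A *m A)) (\tr (A *m A *m (A *m A))) => a b; field.
have hkA : k^T *m (eta *m A) = 0.
  by rewrite -[_ *m _]trmxK trmx_mul hFA trmxK mulNmx -mulmxA hk mulmx0 oppr0 trmx0.
by rewrite mulmxN mulNmx opprK -!mulmxA (mulmxA eta) (mulmxA k^T) hkA mul0mx mulmx0.
Qed.

(** The reflection takes [- e0] to [k] and is then negated: [k + e0] is always timelike, whereas
    [k - e0] may vanish. *)
Lemma lorentz_frame_at k : cone k -> bil eta k k = -1 -> exists P, lorentz P /\ P *m e0 = k.
Proof.
move=> [k0 _] hk.
have [||Q [hQ hQe]] := @reflection R 5 eta k (- e0) (eta_tr R).
- by rewrite hk bilN1 bilN2 opprK eta_e00.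
- rewrite opprK !(bilD1, bilD2) (bil_sym k) ?eta_tr // hk eta_e00 eta_e0 lt_eqF //; lra.
exists (- Q); split; last by rewrite mulNmx -mulmxN.
by rewrite /lorentz [(- Q)^T]linearN /= mulmxN !mulNmx opprK.
Qed.

Lemma lorentz_inv P : lorentz P -> lorentz (invmx P).
Proof.
move=> hP; have hu := lorentz_unit hP.
by rewrite /lorentz -{1}(hP : _ = _) trmx_inv !mulmxA mulmxK // mulVmx ?unitmx_tr // mul1mx.
Qed.

Lemma bil_timelike_unit u : cone u -> bil eta u u < 0 ->
  exists a, [/\ 0 < a, cone (a *: u) & bil eta (a *: u) (a *: u) = -1].
Proof.
move=> hu huu; have huu' : 0 < - bil eta u u by rewrite oppr_gt0.
exists (Num.sqrt (- bil eta u u))^-1; rewrite invr_gt0 sqrtr_gt0; split=> //.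
  by apply: coneZ => //; rewrite invr_ge0 sqrtr_ge0.
rewrite bilZ1 bilZ2 mulrA -invfM -expr2 sqr_sqrtr ?ltW // invrN mulNr mulVf //.
by rewrite lt_eqF.
Qed.

(** A timelike [u] is normalized and taken as the time axis of a new frame, which reduces to [e0]. A
    null [u] is perturbed to the timelike [u + e e0]. *)
Lemma minus_square_dec T : minus_square T -> cone_dominant T.
Proof.
move=> hT.
have ht u v : cone u -> bil eta u u < 0 -> cone v -> 0 <= bil (eta *m T) u v.
  move=> hu huu hv; have [a [a0 hk hkk]] := bil_timelike_unit hu huu.
  have [P [hP hPe]] := lorentz_frame_at hk hkk; have hPu := lorentz_unit hP.
  have hPi := lorentz_inv hP.
  have hTP : minus_square (in_frame P T).
    by apply: (minus_square_lorentz hPi); rewrite in_frameK.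
  have hPe' : cone (invmx P *m e0).
    have h1 : bil eta (invmx P *m e0) (invmx P *m e0) = -1 by rewrite lorentz_bil // eta_e00.
    split; last by rewrite h1 lerN10.
    rewrite -oppr_le0 -eta_e0 -(lorentz_bil _ _ hP) mulKVmx // hPe.
    by apply: cone_dot => //; exact: cone_e0.
  have := minus_square_dec_e0 hTP (cone_lorentz hPi hPe' hv).
  rewrite -{1}(hP : _ = _) in_frame_lower // bil_frame mulKVmx // hPe bilZ1.
  by rewrite pmulr_rge0.
move=> u v hu hv; rewrite leNgt; apply/negP => hlt.
have he := minus_square_dec_e0 hT hv; set m := bil _ u v in hlt; set n := bil _ e0 v in he.
(* Chosen so that [m + e n = - e < 0], contradicting the timelike case. *)
pose e := - m / (n + 1); have n1 : 0 < n + 1 by lra.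
have e_gt0 : 0 < e by rewrite divr_gt0 // oppr_gt0.
have : 0 <= bil (eta *m T) (u + e *: e0) v.
  apply: ht => //; first by apply: coneD => //; apply: coneZ (ltW e_gt0) (cone_e0 R).
  rewrite !(bilD1, bilD2, bilZ1, bilZ2) eta_e00 (bil_sym u) ?eta_tr // eta_e0.
  case: hu => u0 hu; nra.
rewrite bilD1 bilZ1 -/m -/n => h; have : e * (n + 1) = - m by rewrite divfK // gt_eqF.
lra.
Qed.

End Superenergy.

(** * Symmetric matrices annihilated by a cubic *)

Section Spectral.
Variable R : realType.
Implicit Types (g T M P A : 'M[R]_5) (u v w : 'cV[R]_5).
Notation eta := (minkowski5 R).

Lemma bil1E n (u : 'cV[R]_n) : bil 1%:M u u = \sum_i u i 0 ^+ 2.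
Proof. by rewrite /bil mulmx1 mxE; apply: eq_bigr => i _; rewrite mxE expr2. Qed.

Lemma bil1_ge0 n (u : 'cV[R]_n) : 0 <= bil 1%:M u u.
Proof. by rewrite bil1E sumr_ge0 // => i _; rewrite sqr_ge0. Qed.

Lemma bil1_eq0 n (u : 'cV[R]_n) : (bil 1%:M u u == 0) = (u == 0).
Proof.
rewrite bil1E psumr_eq0; last by move=> i _; rewrite sqr_ge0.
apply/allP/eqP => [h|-> i _]; last by rewrite mxE expr0n /= eqxx.
by apply/colP => i; rewrite mxE; apply/eqP; rewrite -sqrf_eq0; exact: h (mem_index_enum i).
Qed.

(** A nonzero column of [C^2 - c] is an eigenvector for [t]. If [C^2 = c], symmetry gives [c >= 0],
    and [(C - b)(C + b) = 0] with [b^2 = c] yields an eigenvector for [b] or [- b]. *)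
Lemma cubic_eigenvector n (C : 'M[R]_n.+1) (c t : R) : C^T = C ->
  (C *m C - c%:M) *m (C - t%:M) = 0 -> exists (v : 'cV_n.+1) a, v != 0 /\ C *m v = a *: v.
Proof.
move=> hC hb; have hb' : (C - t%:M) *m (C *m C - c%:M) = 0.
  by rewrite -[RHS]hb; apply: comm_mx_shift; rewrite /comm_mx mulmxA.
have [hCC|hCC] := eqVneq (C *m C) c%:M; last first.
  have [j hj] : exists j, col j (C *m C - c%:M) != 0.
    apply/existsP; apply: contraNT hCC; rewrite negb_exists => /forallP h.
    rewrite -subr_eq0; apply/eqP/matrixP => i j; rewrite [RHS]mxE.
    by have /negPn/eqP/colP/(_ i) := h j; rewrite !mxE.
  exists (col j (C *m C - c%:M)), t; split=> //; apply/eqP.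
  by rewrite -subr_eq0 -mul_scalar_mx -mulmxBl colE mulmxA hb' mul0mx.
pose x : 'cV[R]_n.+1 := delta_mx 0 0.
have xn0 : x != 0.
  by apply/eqP => /colP /(_ 0); rewrite !mxE /= => /eqP; rewrite oner_eq0.
have x_gt0 : 0 < bil 1%:M x x by rewrite lt_def bil1_eq0 xn0 bil1_ge0.
have c0 : 0 <= c.
  have : bil 1%:M (C *m x) (C *m x) = c * bil 1%:M x x.
    by rewrite -bil_frame hC mulmx1 hCC -bilZ2 -mul_scalar_mx bilM2 mul1mx.
  by move=> h; rewrite -(pmulr_lge0 _ x_gt0) -h bil1_ge0.
pose b := Num.sqrt c; have b2 : b * b = c by rewrite -expr2 sqr_sqrtr.
have [v0|vn0] := eqVneq (C *m x + b *: x) 0.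
  by exists x, (- b); split=> //; apply/eqP; rewrite scaleNr -addr_eq0 v0.
exists (C *m x + b *: x), b; split=> //.
by rewrite mulmxDr mulmxA hCC mul_scalar_mx -scalemxAr scalerDr scalerA b2 addrC.
Qed.

Lemma orthogonal_frame n (x : 'cV[R]_n.+1) : bil 1%:M x x = 1 ->
  exists Q : 'M[R]_n.+1, Q^T *m Q = 1%:M /\ Q *m delta_mx 0 0 = x.
Proof.
move=> hx; have [<-|hne] := eqVneq (delta_mx 0 0) x.
  by exists 1%:M; rewrite trmx1 !mul1mx.
have [|||Q [hQ hQe]] := @reflection R n.+1 1%:M x (delta_mx 0 0).
- exact: trmx1.
- by rewrite hx /bil trmx_delta mulmx1 mul_delta_mx mxE.
- by rewrite bil1_eq0 subr_eq0 eq_sym.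
by exists Q; rewrite mulmx1 in hQ.
Qed.

(** Deflation: rotate a unit eigenvector to the first axis; by symmetry the complement splits off as
    a block, which inherits the cubic equation. *)
Lemma spectral_cubic n (C : 'M[R]_n) (c t : R) : C^T = C ->
  (C *m C - c%:M) *m (C - t%:M) = 0 ->
  exists (O : 'M[R]_n) d, O^T *m O = 1%:M /\ O^T *m C *m O = diag_mx d.
Proof.
elim: n C => [|n IHn] C hC hb.
  by exists 1%:M, 0; split; apply/matrixP => -[].
have [v [a [vn0 hv]]] := cubic_eigenvector hC hb.
have v_gt0 : 0 < bil 1%:M v v by rewrite lt_def bil1_eq0 vn0 bil1_ge0.
pose x := (Num.sqrt (bil 1%:M v v))^-1 *: v.
have [|Q [hQ hQe]] := @orthogonal_frame n x.
  rewrite /x bilZ1 bilZ2 mulrA -invfM -expr2 sqr_sqrtr ?bil1_ge0 //.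
  by rewrite mulVf // gt_eqF.
have hx : C *m x = a *: x by rewrite -scalemxAr hv scalerA mulrC -scalerA.
have hQu : Q \in unitmx by case/mulmx1_unit: hQ.
have hQQ : Q *m Q^T = 1%:M by exact: mulmx1C.
have [D hD] : exists D : 'M[R]_n.+1, D = Q^T *m C *m Q by eexists.
have hDt : D^T = D by rewrite hD !trmx_mul trmxK hC mulmxA.
have hD0 : D *m delta_mx 0 0 = a *: delta_mx 0 0 :> 'cV_n.+1.
  by rewrite hD -!mulmxA hQe hx -scalemxAr -hQe mulmxA hQ mul1mx.
pose C1 := @drsubmx R 1 n 1 n D.
have hDE : D = block_mx a%:M 0 0 C1 :> 'M_(1 + n).
  have hcol i : D i 0 = a * (i == 0)%:R.
    by have /colP/(_ i) := hD0; rewrite -colE !mxE andbT.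
  have hrow i : D 0 i = a * (i == 0)%:R by rewrite -hDt mxE hcol.
  rewrite -[LHS](@submxK R 1 n 1 n); congr block_mx; apply/matrixP => i j; rewrite !mxE.
  - by rewrite (ord1 i) (ord1 j) [lshift _ _](_ : _ = 0) ?hcol ?mulr1; last exact: val_inj.
  - by rewrite (ord1 i) [lshift _ _](_ : _ = 0) ?hrow ?mulr0; last exact: val_inj.
  - by rewrite (ord1 j) [lshift _ _](_ : _ = 0) ?hcol ?mulr0; last exact: val_inj.
have hDb : (D *m D - c%:M) *m (D - t%:M) = 0.
  have hs z : z%:M = Q^T *m z%:M *m Q by rewrite mul_mx_scalar -scalemxAl hQ scalemx1.
  have hDD : D *m D = Q^T *m (C *m C) *m Q.
    by rewrite hD -!mulmxA (mulmxA Q) hQQ mul1mx.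
  have -> : D *m D - c%:M = Q^T *m (C *m C - c%:M) *m Q.
    by rewrite hDD mulmxBr mulmxBl -hs.
  have -> : D - t%:M = Q^T *m (C - t%:M) *m Q by rewrite mulmxBr mulmxBl -hs hD.
  by rewrite -!mulmxA (mulmxA Q) hQQ mul1mx (mulmxA _ _ Q) hb mul0mx mulmx0.
have [||O1 [d1 [hO1 hd1]]] := IHn C1.
- by rewrite /C1 trmx_drsub hDt.
- pose B : 'M_(1 + n) := block_mx a%:M 0 0 C1.
  have : (B *m B - c%:M) *m (B - t%:M) = 0 by rewrite /B -hDE.
  rewrite /B mulmx_block !(mulmx0, mul0mx, addr0, add0r) !(@scalar_mx_block R 1 n).
  rewrite !(opp_block_mx, add_block_mx) !(oppr0, addr0).
  rewrite mulmx_block !(mulmx0, mul0mx, addr0, add0r) => /(congr1 (@drsubmx _ 1 n 1 n)).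
  by rewrite block_mxKdr => ->; apply/matrixP => i j; rewrite !mxE.
pose O2 : 'M_(1 + n) := block_mx 1%:M 0 0 O1.
have hO2 : O2^T *m O2 = 1%:M.
  rewrite /O2 tr_block_mx mulmx_block.
  by rewrite !(trmx0, trmx1, mulmx0, mul0mx, addr0, add0r, mulmx1) hO1 -scalar_mx_block.
have hO2D : O2^T *m block_mx a%:M 0 0 C1 *m O2 = diag_mx (row_mx a%:M d1).
  rewrite /O2 tr_block_mx !mulmx_block.
  rewrite !(trmx0, trmx1, mulmx0, mul0mx, addr0, add0r, mulmx1, mul1mx) hd1.
  by rewrite diag_mx_row; congr block_mx; apply/matrixP => i j; rewrite !mxE !(ord1 i, ord1 j).
exists (Q *m O2), (row_mx a%:M d1); split.
  by rewrite trmx_mul mulmxA -(mulmxA _ Q^T) hQ mulmx1.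
by rewrite -hO2D -hDE hD trmx_mul !mulmxA.
Qed.

Lemma sort_rV n (d : 'rV[R]_n) :
  exists s : 'S_n, forall i j : 'I_n, (i <= j)%N -> d 0 (s i) <= d 0 (s j).
Proof.
pose u := [tuple d 0 i | i < n].
have /tuple_permP [s hs] : perm_eq (sort <=%R u) u by rewrite perm_sort.
exists s => i j hij.
have hsz : size (sort <=%R u) = n by rewrite size_sort size_tuple.
have hn (k : 'I_n) : nth 0 (sort <=%R u) k = d 0 (s k).
  by rewrite hs -tnth_nth !tnth_mktuple.
rewrite -!hn; apply: (sorted_leq_nth le_trans lexx) => //; rewrite ?inE ?hsz //.
exact: sort_sorted le_total _.
Qed.

(** Ordering the eigenvalues, by a permutation matrix, leaves fewer cases in the analysis of the
    spectrum. *)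
Lemma spectral_cubic_sorted n (C : 'M[R]_n) (c t : R) : C^T = C ->
  (C *m C - c%:M) *m (C - t%:M) = 0 ->
  exists (O : 'M[R]_n) d, [/\ O^T *m O = 1%:M, O^T *m C *m O = diag_mx d &
    forall i j : 'I_n, (i <= j)%N -> d 0 i <= d 0 j].
Proof.
move=> hC hb; have [O [d [hO hd]]] := spectral_cubic hC hb.
have [s hs] := sort_rV d; pose S : 'M[R]_n := perm_mx s.
have hS : S *m S^T = 1%:M by rewrite /S tr_perm_mx -perm_mxM mulgV perm_mx1.
exists (O *m S^T), (\row_i d 0 (s i)); split.
- by rewrite trmx_mul trmxK -!mulmxA (mulmxA O^T) hO mul1mx.
- have -> : (O *m S^T)^T *m C *m (O *m S^T) = S *m (O^T *m C *m O) *m S^T.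
    by rewrite trmx_mul trmxK !mulmxA.
  rewrite hd /S tr_perm_mx -row_permE -col_permE; apply/matrixP => i j; rewrite !mxE.
  by rewrite (inj_eq perm_inj).
- by move=> i j hij; rewrite !mxE; exact: hs.
Qed.

(** The cubic allows each [p_i] the values [l], [- l] and [t]. In each combination the order and the
    linear trace give the conclusion, a contradiction, or [t] as a fixed multiple of [l] that the
    quadratic trace excludes. *)
Lemma spectrum_mixed (F : realFieldType) (l p1 p2 p3 p4 t : F) : 0 < l ->
  - l <= p1 -> p1 <= p2 -> p2 <= p3 -> p3 <= p4 -> p4 <= l -> t = - l + p1 + p2 + p3 + p4 ->
  4 * l ^+ 2 = l ^+ 2 + p1 ^+ 2 + p2 ^+ 2 + p3 ^+ 2 + p4 ^+ 2 - t ^+ 2 ->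
  (p1 ^+ 2 - l ^+ 2) * (p1 - t) = 0 -> (p2 ^+ 2 - l ^+ 2) * (p2 - t) = 0 ->
  (p3 ^+ 2 - l ^+ 2) * (p3 - t) = 0 -> (p4 ^+ 2 - l ^+ 2) * (p4 - t) = 0 ->
  [/\ p1 = - l, p2 = t, p3 = l & p4 = l].
Proof.
move=> l0 h0 h1 h2 h3 h4 ht hc.
have l2 : 0 < l ^+ 2 by rewrite exprn_gt0.
have sq (x : F) : (x ^+ 2 - l ^+ 2) * (x - t) = 0 -> [\/ x = l, x = - l | x = t].
  move/eqP; rewrite mulf_eq0 subr_eq0 eqf_sqr subr_eq0.
  by case/orP => [/orP [] /eqP ->|/eqP ->]; [exact: Or31 | exact: Or32 | exact: Or33].
move=> /sq q1 /sq q2 /sq q3 /sq q4; clear sq.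
case: q1 => e1; case: q2 => e2; case: q3 => e3; case: q4 => e4;
  first [by exfalso; clear hc l2; lra | by clear hc l2; split; lra | exfalso;
    first [have hk : t = 3 * l by clear hc l2; lra | have hk : t = - 3 * l by clear hc l2; lra
    | have hk : t = - 5 * l by clear hc l2; lra | have hk : t = 3^-1 * l by clear hc l2; lra
    | have hk : t = 0 * l by clear hc l2; lra ];
    by rewrite hk in e1 e2 e3 e4 hc; rewrite e1 e2 e3 e4 in hc; lra].
Qed.

Lemma spectrum_paired (F : realFieldType) (p1 p2 p3 p4 c : F) :
  p1 <= p2 -> p2 <= p3 -> p3 <= p4 -> p1 + p2 + p3 + p4 = 0 ->
  p1 ^+ 2 = c -> p2 ^+ 2 = c -> p3 ^+ 2 = c -> p4 ^+ 2 = c ->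
  [/\ p1 = p2, p3 = p4 & p1 = - p3].
Proof.
move=> h1 h2 h3 hs q1 q2 q3 q4.
have /eqP : p2 ^+ 2 = p1 ^+ 2 by rewrite q2.
have /eqP : p4 ^+ 2 = p1 ^+ 2 by rewrite q4.
rewrite !eqf_sqr {q1 q2 q3 q4} => /orP [] /eqP e4 /orP [] /eqP e2; split; lra.
Qed.

(* [- l, p1, ..., p4] is the spectrum of [T], [t = [T]] and [c = ([T^2] - [T]^2) / 4]. *)
Lemma spectrum_dichotomy (F : realFieldType) (l p1 p2 p3 p4 t c : F) :
  t = - l + p1 + p2 + p3 + p4 ->
  4 * c = l ^+ 2 + p1 ^+ 2 + p2 ^+ 2 + p3 ^+ 2 + p4 ^+ 2 - t ^+ 2 ->
  - l <= p1 -> p1 <= p2 -> p2 <= p3 -> p3 <= p4 -> p4 <= l ->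
  (l ^+ 2 - c) * (- l - t) = 0 -> (p1 ^+ 2 - c) * (p1 - t) = 0 ->
  (p2 ^+ 2 - c) * (p2 - t) = 0 -> (p3 ^+ 2 - c) * (p3 - t) = 0 ->
  (p4 ^+ 2 - c) * (p4 - t) = 0 ->
  [/\ p1 = - l, p2 = t, p3 = l & p4 = l] \/ [/\ t = - l, p1 = p2, p3 = p4 & p1 = - p3].
Proof.
move=> ht hc h0 h1 h2 h3 h4 hl q1 q2 q3 q4.
have l0 : 0 <= l by lra.
have [hcl|hcl] := eqVneq (l ^+ 2) c.
  (* If [l = 0], the bounds force every [p_i] to vanish. *)
  subst c; move: l0; rewrite le_eqVlt => /orP [/eqP l0|l0]; left; last exact: spectrum_mixed.
  by clear hc hl q1 q2 q3 q4; split; lra.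
right; have htl : t = - l.
  by move/eqP: hl; rewrite mulf_eq0 subr_eq0 (negPf hcl) subr_eq0 => /eqP.
have hx (p : F) : (p ^+ 2 - c) * (p - t) = 0 -> p ^+ 2 = c \/ p ^+ 2 = l ^+ 2.
  move/eqP; rewrite mulf_eq0 !subr_eq0 => /orP [] /eqP ->; [by left | right].
  by rewrite htl sqrrN.
have hs : (p1 ^+ 2 - c) + (p2 ^+ 2 - c) + (p3 ^+ 2 - c) + (p4 ^+ 2 - c) = 0.
  by rewrite htl in hc; lra.
(* Each summand of [hs] is 0 or the fixed nonzero number [l^2 - c], so all four are 0. *)
have hcs : [/\ p1 ^+ 2 = c, p2 ^+ 2 = c, p3 ^+ 2 = c & p4 ^+ 2 = c].
  clear -hs hx q1 q2 q3 q4 hcl; move/eqP: hcl => hcl.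
  by case: (hx _ q1) => e1; case: (hx _ q2) => e2; case: (hx _ q3) => e3; case: (hx _ q4) => e4;
    rewrite e1 e2 e3 e4 in hs *; split=> //; exfalso; apply: hcl; lra.
case: hcs => e1 e2 e3 e4.
have [] := spectrum_paired h1 h2 h3 _ e1 e2 e3 e4; last by split.
by clear -ht htl; lra.
Qed.

End Spectral.

(** * Timelike eigenvectors *)

Section Blocks.
Variable R : realType.
Implicit Types (g T M P A : 'M[R]_5) (u v w : 'cV[R]_5).
Notation eta := (minkowski5 R).

Section BlockMatrices.
Variables (m n : nat).

Lemma block_rotation (G : 'M[R]_m) (O : 'M[R]_n) : O^T *m O = 1%:M ->
  (block_mx 1%:M 0 0 O)^T *m block_mx G 0 0 1%:M *m block_mx 1%:M 0 0 O = block_mx G 0 0 1%:M.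
Proof.
move=> hO; rewrite tr_block_mx !mulmx_block.
by rewrite !(trmx0, trmx1, mulmx0, mul0mx, addr0, add0r, mulmx1, mul1mx) hO.
Qed.

Lemma block_conj (T : 'M[R]_(m + n)) (O : 'M[R]_n) :
  drsubmx ((block_mx 1%:M 0 0 O)^T *m T *m block_mx 1%:M 0 0 O) = O^T *m drsubmx T *m O.
Proof.
rewrite -{1}[T]submxK tr_block_mx !mulmx_block block_mxKdr.
by rewrite !(trmx0, trmx1, mulmx0, mul0mx, addr0, add0r, mulmx1, mul1mx).
Qed.

(** Write [T] as blocks [A], [B] above [D], [C]. From [D B = 0] and [D A = x D] no mixed term
    survives in the lower right block of the cubic. This covers [D = 0] (timelike eigenvector) and
    the nonzero [D] of the null case. *)
Lemma block_cubic (T : 'M[R]_(m + n)) x c t :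
  dlsubmx T *m ursubmx T = 0 -> dlsubmx T *m ulsubmx T = x *: dlsubmx T ->
  (T *m T - c%:M) *m (T - t%:M) = 0 ->
  (drsubmx T *m drsubmx T - c%:M) *m (drsubmx T - t%:M) = 0.
Proof.
move=> hDB hDA; rewrite -{1 2 3}[T]submxK.
move: (ulsubmx T) (ursubmx T) (dlsubmx T) (drsubmx T) hDB hDA => A B D C hDB hDA.
rewrite !scalar_mx_block mulmx_block !(opp_block_mx, add_block_mx) mulmx_block.
move=> /(congr1 drsubmx); rewrite block_mxKdr hDB hDA !(oppr0, addr0, add0r).
rewrite mulmxDl -scalemxAl hDB scaler0 add0r -mulmxA hDB mulmx0 add0r => ->.
by apply/matrixP => i j; rewrite !mxE.
Qed.
End BlockMatrices.

Lemma eigen_cubic T v p : v != 0 -> T *m v = p *: v -> condition_b T ->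
  (p ^+ 2 - (4^-1 * \tr (T *m T) - 4^-1 * (\tr T) ^+ 2)) * (p - \tr T) = 0.
Proof.
move=> vn0 hv /condition_bE; set c := 4^-1 * _ - _; set t := \tr T => hb.
have h1 : (T - t%:M) *m v = (p - t) *: v by rewrite mulmxBl hv mul_scalar_mx -scalerBl.
have h2 : (T *m T - c%:M) *m v = (p ^+ 2 - c) *: v.
  by rewrite mulmxBl -mulmxA hv -scalemxAr hv scalerA mul_scalar_mx -scalerBl expr2.
have : ((p ^+ 2 - c) * (p - t)) *: v = 0.
  by rewrite mulrC -scalerA -h2 scalemxAr -h1 mulmxA hb mul0mx.
by move/eqP; rewrite scaler_eq0 (negPf vn0) orbF => /eqP.
Qed.

Lemma eta_block14 : eta = block_mx (-1)%:M 0 0 1%:M :> 'M_(1 + 4).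
Proof.
rewrite -[LHS](@submxK R 1 4 1 4); congr block_mx; apply/matrixP => i j; rewrite !mxE //.
- by rewrite !ord1 /= mulr1n.
- by rewrite !ord1.
- by rewrite !ord1.
- by rewrite (inj_eq (@rshift_inj 1 4)); case: (i == j).
Qed.

Lemma rshift14 (i : 'I_4) : rshift 1 i = lift ord0 i :> 'I_5.
Proof. exact: val_inj. Qed.

Lemma orthogonal_lorentz P (S := P^T *m P) : lorentz P -> P^T *m P = 1%:M -> forall T,
  in_frame P T = P^T *m T *m P.
Proof.
move=> hP hPP T; rewrite /in_frame; congr (_ *m _ *m _).
have hu := lorentz_unit hP.
by rewrite -[RHS](mulmxK hu) hPP mul1mx.
Qed.

Definition diag5 (l p1 p2 p3 p4 : R) := mx5
  [:: [:: - l; 0; 0; 0; 0]; [:: 0; p1; 0; 0; 0]; [:: 0; 0; p2; 0; 0];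
      [:: 0; 0; 0; p3; 0]; [:: 0; 0; 0; 0; p4]].

Lemma diag5_bil (l p1 p2 p3 p4 : R) u v : bil (eta *m diag5 l p1 p2 p3 p4) u v =
  l * (u o0 0 * v o0 0) + p1 * (u o1 0 * v o1 0) + p2 * (u o2 0 * v o2 0)
  + p3 * (u o3 0 * v o3 0) + p4 * (u o4 0 * v o4 0).
Proof. by rewrite -bilM2 etaE !mxE !sum5 !mxE /=; ring. Qed.

(** On the null vectors [e0 + e_i] and [e0 - e_i], the dominant energy condition reads
    [l + p_i >= 0] and [l - p_i >= 0]. *)
Lemma diag5_dec (l p1 p2 p3 p4 : R) : cone_dominant (diag5 l p1 p2 p3 p4) ->
  [/\ `|p1| <= l, `|p2| <= l, `|p3| <= l & `|p4| <= l].
Proof.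
move=> hD; pose e i s : 'cV[R]_5 := e0 + s *: delta_mx i 0.
have he i s : i != o0 -> s ^+ 2 = 1 -> cone (e i s).
  move=> hi hs; split; first by rewrite !mxE eqxx eq_sym (negPf hi) /= mulr0 addr0.
  rewrite etaE !mxE !andbT !eqxx; move: i hi; apply: forall5 => //= _;
    rewrite ?mulr0 ?mulr1 ?addr0 ?add0r -?expr2 ?hs; lra.
have cp i hi := he i 1 hi (expr1n _ 2); have cm i hi := he i (-1) hi (sqrr_sign _ 1).
have hp i (hi : i != o0) := hD _ _ (cp i hi) (cp i hi).
have hm i (hi : i != o0) := hD _ _ (cp i hi) (cm i hi).
split; rewrite ler_norml.
- by have := hp o1 isT; have := hm o1 isT; rewrite !diag5_bil !mxE /=; lra.
- by have := hp o2 isT; have := hm o2 isT; rewrite !diag5_bil !mxE /=; lra.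
- by have := hp o3 isT; have := hm o3 isT; rewrite !diag5_bil !mxE /=; lra.
- by have := hp o4 isT; have := hm o4 isT; rewrite !diag5_bil !mxE /=; lra.
Qed.

Lemma diag5_tr (l p1 p2 p3 p4 : R) (T := diag5 l p1 p2 p3 p4) :
  \tr T = - l + p1 + p2 + p3 + p4 /\
  \tr (T *m T) = l ^+ 2 + p1 ^+ 2 + p2 ^+ 2 + p3 ^+ 2 + p4 ^+ 2.
Proof. by rewrite /mxtrace !sum5; split; rewrite !mxE // !sum5 !mxE /=; ring. Qed.

Lemma diag5_e0 (l p1 p2 p3 p4 : R) : diag5 l p1 p2 p3 p4 *m e0 = (- l) *: e0.
Proof. by apply/colP; apply: forall5; rewrite mxE sum5 !mxE /=; ring. Qed.

Lemma minus_square_diag5 (l p1 p2 p3 p4 : R) (T := diag5 l p1 p2 p3 p4)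
    (c := 4^-1 * \tr (T *m T) - 4^-1 * (\tr T) ^+ 2) :
  cone_dominant T -> condition_b T -> p1 <= p2 -> p2 <= p3 -> p3 <= p4 ->
  (p1 ^+ 2 - c) * (p1 - \tr T) = 0 -> (p2 ^+ 2 - c) * (p2 - \tr T) = 0 ->
  (p3 ^+ 2 - c) * (p3 - \tr T) = 0 -> (p4 ^+ 2 - c) * (p4 - \tr T) = 0 ->
  minus_square T.
Proof.
move=> hD hb h1 h2 h3 q1 q2 q3 q4.
have ql := eigen_cubic (e0_neq0 R) (diag5_e0 l p1 p2 p3 p4) hb.
rewrite -/T -/c sqrrN in ql.
have [] := diag5_dec hD; rewrite !ler_norml => /andP[a1 b1] /andP[a2 b2] /andP[a3 b3] /andP[a4 b4].
have [htr htr2] := diag5_tr l p1 p2 p3 p4; rewrite -/T in htr htr2.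
have hc : 4 * c = l ^+ 2 + p1 ^+ 2 + p2 ^+ 2 + p3 ^+ 2 + p4 ^+ 2 - (\tr T) ^+ 2.
  by rewrite /c htr2; field.
have := spectrum_dichotomy htr hc a1 h1 h2 h3 b4 ql q1 q2 q3 q4.
rewrite /minus_square; move: (\tr T) => t [[e1 e2 e3 e4]|[e1 e2 e3 e4]].
  (* A boost in the plane of [e0], [e1] and a rotation in that of [e3], [e4]: [- A^2] has diagonal
     [(- a^2, - a^2, 0, b^2, b^2)]. *)
  pose a := Num.sqrt (l + t); pose b := Num.sqrt (l - t).
  have ha : a * a = l + t by rewrite -expr2 sqr_sqrtr //; lra.
  have hb' : b * b = l - t by rewrite -expr2 sqr_sqrtr //; lra.
  exists (so14 a 0 0 0 0 0 0 0 0 b); split; first by apply/so14P; do 10!eexists.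
  by apply/matrixP; do 2![apply: forall5]; rewrite !mxE sum5 !mxE /= ?e1 ?e2 ?e3 ?e4
    ?(mulr0, mul0r, addr0, add0r, oppr0, subr0, mulr0n, mulr1n, mulNr, mulrN, opprK) ?ha ?hb'; ring.
(* Here [t = - l], so [T - t] annihilates [e0]; [A] rotates the planes of [e1], [e2] and of [e3],
   [e4]. *)
pose a := Num.sqrt (l + p1); pose b := Num.sqrt (l + p3).
have ha : a * a = l + p1 by rewrite -expr2 sqr_sqrtr //; lra.
have hb' : b * b = l + p3 by rewrite -expr2 sqr_sqrtr //; lra.
exists (so14 0 0 0 0 a 0 0 0 0 b); split; first by apply/so14P; do 10!eexists.
by apply/matrixP; do 2![apply: forall5]; rewrite !mxE sum5 !mxE /= ?e1 -?e2 -?e3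
    ?(mulr0, mul0r, addr0, add0r, oppr0, subr0, mulr0n, mulr1n, mulNr, mulrN, opprK) ?ha ?hb'; ring.
Qed.

End Blocks.

Section Timelike.
Variable R : realType.
Implicit Types (g T M P A : 'M[R]_5) (u v w : 'cV[R]_5).
Notation eta := (minkowski5 R).

Lemma lshift14 (i : 'I_1) : lshift 4 i = o0 :> 'I_5.
Proof. by rewrite (ord1 i); exact: val_inj. Qed.

Lemma diag_mx_cubic n (d : 'rV[R]_n) c t i :
  ((diag_mx d *m diag_mx d - c%:M) *m (diag_mx d - t%:M)) i i = (d 0 i ^+ 2 - c) * (d 0 i - t).
Proof.
rewrite -!diag_const_mx mulmx_diag -!raddfB /= mulmx_diag !mxE eqxx mulr1n.
by rewrite expr2.
Qed.

Lemma in_frame_eigen P T u v r : P \in unitmx -> P *m u = v -> T *m v = r *: v ->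
  in_frame P T *m u = r *: u.
Proof.
by move=> hP hu hv; rewrite /in_frame -!mulmxA hu hv -scalemxAr -hu mulKmx.
Qed.

Lemma eta_sym_entry T : g_symmetric eta T ->
  [/\ forall i, i != o0 -> T o0 i = - T i o0 & forall i j, i != o0 -> j != o0 -> T i j = T j i].
Proof.
move=> hT; have h i j : (eta *m T) j i = (eta *m T) i j.
  by move/matrixP/(_ i j): hT; rewrite mxE.
split=> [i /negPf hi|i j /negPf hi /negPf hj].
  by have := h o0 i; rewrite !eta_mulE hi /= => ->; rewrite opprK.
by have := h j i; rewrite !eta_mulE hi hj.
Qed.

Lemma rotation14 (O : 'M[R]_4) (E : 'M[R]_5 := @block_mx R 1 4 1 4 1%:M 0 0 O) :
  O^T *m O = 1%:M -> [/\ lorentz E, E^T *m E = 1%:M & E *m e0 = e0].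
Proof.
move=> hO; split.
- by have := @block_rotation R 1 4 (-1)%:M _ hO; rewrite -eta_block14.
- have := @block_rotation R 1 4 1%:M _ hO; rewrite -scalar_mx_block mulmx1; exact.
apply/colP => i; rewrite -colE mxE e0E; case: (unliftP ord0 i) => [j|] ->.
  have := @block_mxEdl R 1 4 1 4 1%:M 0 0 O j ord0.
  by rewrite rshift14 lshift14 -/E => ->; rewrite mxE.
have := @block_mxEul R 1 4 1 4 1%:M 0 0 O ord0 ord0.
by rewrite lshift14 -/E => ->; rewrite mxE eqxx.
Qed.

(** With the eigenvector as time axis, the spatial block is a Euclidean symmetric matrix satisfying
    the cubic; a spatial rotation diagonalizes it and [minus_square_diag5] applies. *)
Lemma minus_square_timelike T v r : g_symmetric eta T -> cone_dominant T -> condition_b T ->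
  T *m v = r *: v -> bil eta v v < 0 -> minus_square T.
Proof.
move=> hs hD hb.
wlog hv : v / cone v.
  move=> hwlog hv hvv; have [v0|v0] := lerP 0 (v o0 0).
    by apply: (hwlog v) => //; split=> //; exact: ltW.
  apply: (hwlog (- v)); rewrite ?bilN1 ?bilN2 ?opprK ?mulmxN ?hv ?scalerN //.
  by apply: coneN; exact: ltW.
move=> hTv hvv; have [a [a0 hk hkk]] := bil_timelike_unit hv hvv.
have [P [hP hPe]] := lorentz_frame_at hk hkk; have hPu := lorentz_unit hP.
have hTk : T *m (a *: v) = r *: (a *: v) by rewrite -scalemxAr hTv !scalerA mulrC.
have hTe := in_frame_eigen hPu hPe hTk.
apply: (minus_square_lorentz hP).
have {}hs := g_symmetric_lorentz hP hs.
have {}hD : cone_dominant (in_frame P T) by apply: cone_dominant_lorentz => //; rewrite hPe.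
move: hb; rewrite (condition_b_frame _ hPu) => hb.
move: (in_frame P T) hTe hs hD hb => {T P v a a0 hv hvv hTv hk hkk hP hPe hPu hTk} T hTe hs hD hb.
have col0 (M : 'M[R]_5) : M *m e0 = r *: e0 -> @dlsubmx R 1 4 1 4 M = 0.
  move=> hM; apply/matrixP => i j; rewrite !mxE ord1.
  have /colP/(_ (rshift 1 i)) := hM; rewrite -colE !mxE rshift14 /= mulr0 => h.
  by rewrite -[RHS]h; congr (M _ _); exact: val_inj.
have [hs0 hss] := eta_sym_entry hs; pose C := @drsubmx R 1 4 1 4 T.
have hC : C^T = C by apply/matrixP => i j; rewrite !mxE hss // rshift14.
have hCb := (condition_bE T).1 hb.
have hCb' := @block_cubic R 1 4 T 0 _ _ _ _ hCb.
have {hCb hCb'} [||O [d [hO hd hsort]]] := spectral_cubic_sorted hC (hCb' _ _).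
- by rewrite col0 // mul0mx.
- by rewrite col0 // mul0mx scaler0.
have [hE hEE hEe] := rotation14 hO; set E := block_mx _ _ _ _ in hE hEE hEe.
have hEu := lorentz_unit hE.
apply: (minus_square_lorentz hE).
have hTe' := in_frame_eigen hEu hEe hTe.
have hs' := g_symmetric_lorentz hE hs.
have hD' : cone_dominant (in_frame E T).
  by apply: cone_dominant_lorentz => //; rewrite hEe; exact: cone_e0.
have hb' := (condition_b_frame T hEu).1 hb.
have hdr : @drsubmx R 1 4 1 4 (in_frame E T) = diag_mx d.
  by rewrite orthogonal_lorentz // /E block_conj hd.
move: (in_frame E T) hTe' hs' hD' hb' hdr => {T hTe hs hD hb hs0 hss C hC E hE hEE hEe hEu hd O hO}.
move=> T hTe hs hD hb hdr; have [hs0 hss] := eta_sym_entry hs.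
have hTc i : T i o0 = r * (i == o0)%:R by have /colP/(_ i) := hTe; rewrite -colE !mxE andbT.
have hTd i j : T (lift ord0 i) (lift ord0 j) = diag_mx d i j by rewrite -hdr !mxE !rshift14.
have hTE : T = diag5 (- r) (d 0 ord0) (d 0 (lift ord0 ord0)) (d 0 (lift ord0 (lift ord0 ord0)))
    (d 0 (lift ord0 (lift ord0 (lift ord0 ord0)))).
  apply/matrixP; do 2![apply: forall5]; rewrite ?hTd ?hTc ?[T o0 _]hs0 // ?hTc !mxE //=;
    by rewrite ?opprK ?mulr1 ?mulr0 ?oppr0.
have hTb := (condition_bE T).1 hb.
have {}hTb := @block_cubic R 1 4 T 0 _ _ _ _ hTb.
have hq i : (d 0 i ^+ 2 - (4^-1 * \tr (T *m T) - 4^-1 * \tr T ^+ 2)) * (d 0 i - \tr T) = 0.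
  by rewrite -diag_mx_cubic -hdr hTb ?mxE // col0 // ?mul0mx ?scaler0.
by rewrite hTE; apply: minus_square_diag5; rewrite -?hTE //; exact: hsort.
Qed.

End Timelike.

(** * Null eigenvectors *)

Section NullTensors.
Variable R : realType.
Implicit Types (g T M P A : 'M[R]_5) (u v w : 'cV[R]_5).
Notation eta := (minkowski5 R).

(* The eigenspace of [- l] contains [w := (T - l) (T - t) e0], which is not orthogonal to [k], so
   the span of [k] and [w] is a Lorentzian plane. *)
Lemma timelike_eigenvector_of_null T k l (t := \tr T) : g_symmetric eta T ->
  (T *m T - (l ^+ 2)%:M) *m (T - t%:M) = 0 -> cone k -> k != 0 -> bil eta k k = 0 ->
  T *m k = - l *: k -> l != 0 -> l + t != 0 ->
  exists2 v, T *m v = - l *: v & bil eta v v < 0.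
Proof.
move=> hs hb hk kn0 hkk hTk l0 lt0.
have hsa u v : bil eta (T *m u) v = bil eta u (T *m v).
  by rewrite bilM1 bilM2 -{1}eta_tr -trmx_mul (hs : _ = _).
pose y := (T - t%:M) *m e0.
have [w hw] : exists w, w = T *m y - l *: y by eexists.
have hTw : T *m w = - l *: w.
  have : (T *m T - (l ^+ 2)%:M) *m y = 0 by rewrite /y mulmxA hb mul0mx.
  rewrite mulmxBl mul_scalar_mx => /eqP; rewrite subr_eq0 -mulmxA => /eqP h.
  by rewrite hw mulmxBr h -scalemxAr scalerBr !scaleNr opprK scalerA -expr2 addrC.
(* Self-adjointness moves [T - l] and [T - t] onto [k], where they act as [- 2 l] and [- l - t]. *)
have hwk : bil eta w k = - (2 * l * (l + t)) * k o0 0.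
  rewrite hw /y mulmxBl mul_scalar_mx -!scaleNr.
  by rewrite !(bilD1, bilZ1) !hsa !hTk !(bilD1, bilZ1, bilZ2) !hsa !hTk !bilZ2 eta_e0; ring.
have k0 := cone_gt0 hk kn0.
have hwk0 : bil eta w k != 0.
  by rewrite hwk mulf_neq0 ?oppr_eq0 ?(gt_eqF k0) //; do 2?apply: mulf_neq0; rewrite // pnatr_eq0.
(* As [k] is null, this multiple of it shifts the norm of [w] to exactly -1. *)
exists (w - ((bil eta w w + 1) / (2 * bil eta w k)) *: k).
  rewrite -scaleNr mulmxDr hTw -scalemxAr hTk scalerDr !scalerA.
  by congr (_ + _ *: _); exact: mulrC.
rewrite -scaleNr !(bilD1, bilD2, bilZ1, bilZ2) hkk (bil_sym k w) ?eta_tr //.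
set q := _ / _; have : q * (2 * bil eta w k) = bil eta w w + 1.
  by rewrite divfK // mulf_neq0 // pnatr_eq0.
lra.
Qed.

(** A symmetric tensor with eigenvector [e0 + e1] of eigenvalue [- l], once its block on [e2], [e3],
    [e4] is diagonal. *)
Definition null5 (l a b1 b2 b3 p1 p2 p3 : R) := mx5
  [:: [:: - l - a; a; - b1; - b2; - b3]; [:: - a; a - l; - b1; - b2; - b3];
      [:: b1; - b1; p1; 0; 0]; [:: b2; - b2; 0; p2; 0]; [:: b3; - b3; 0; 0; p3]].

Definition null_vec : 'cV[R]_5 := \col_i nth 0 [:: 1; 1; 0; 0; 0] i.

Lemma null_vec_cone : [/\ cone null_vec, null_vec != 0 & bil eta null_vec null_vec = 0].
Proof.
have h : bil eta null_vec null_vec = 0 by rewrite etaE !mxE /=; ring.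
split=> //; first by split; rewrite ?h // mxE /= ler01.
by apply/eqP => /colP /(_ o0); rewrite !mxE /= => /eqP; rewrite oner_eq0.
Qed.

Lemma null5_bil (l a b1 b2 b3 p1 p2 p3 : R) u v :
  bil (eta *m null5 l a b1 b2 b3 p1 p2 p3) u v =
  l * (u o0 0 * v o0 0 - u o1 0 * v o1 0) + a * (u o0 0 - u o1 0) * (v o0 0 - v o1 0)
  + (u o0 0 - u o1 0) * (b1 * v o2 0 + b2 * v o3 0 + b3 * v o4 0)
  + (b1 * u o2 0 + b2 * u o3 0 + b3 * u o4 0) * (v o0 0 - v o1 0)
  + p1 * (u o2 0 * v o2 0) + p2 * (u o3 0 * v o3 0) + p3 * (u o4 0 * v o4 0).
Proof. by rewrite -bilM2 etaE !mxE !sum5 !mxE /=; ring. Qed.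

(* [|s|^2 (e0 + e1) + (e0 - e1) + 2 s] with [s] orthogonal to [e0] and [e1]. *)
Definition ray (s1 s2 s3 : R) : 'cV[R]_5 :=
  \col_i nth 0 [:: s1 ^+ 2 + s2 ^+ 2 + s3 ^+ 2 + 1; s1 ^+ 2 + s2 ^+ 2 + s3 ^+ 2 - 1;
                   2 * s1; 2 * s2; 2 * s3] i.

Lemma ray_cone s1 s2 s3 : cone (ray s1 s2 s3).
Proof.
split; first by rewrite mxE /= !addr_ge0 ?sqr_ge0 ?ler01.
by rewrite etaE !mxE /= le_eqVlt; apply/orP; left; apply/eqP; ring.
Qed.

(** A quarter of the values of [T] on the null pairs [ray s, ray s] and [ray s, ray (- s)]. *)
Lemma null5_dec (l a b1 b2 b3 p1 p2 p3 : R) s1 s2 s3 :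
  cone_dominant (null5 l a b1 b2 b3 p1 p2 p3) ->
  0 <= (l + p1) * s1 ^+ 2 + (l + p2) * s2 ^+ 2 + (l + p3) * s3 ^+ 2
       + 2 * (b1 * s1 + b2 * s2 + b3 * s3) + a /\
  0 <= (l - p1) * s1 ^+ 2 + (l - p2) * s2 ^+ 2 + (l - p3) * s3 ^+ 2 + a.
Proof.
move=> hD; have h1 := hD _ _ (ray_cone s1 s2 s3) (ray_cone s1 s2 s3).
have h2 := hD _ _ (ray_cone s1 s2 s3) (ray_cone (- s1) (- s2) (- s3)).
rewrite null5_bil !mxE /= in h1; rewrite null5_bil !mxE /= in h2.
by split; lra.
Qed.

Lemma quadratic_ge0 (x y z : R) : (forall s, 0 <= x * s ^+ 2 + 2 * y * s + z) ->
  0 <= x /\ (x = 0 -> y = 0).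
Proof.
move=> h; have z0 : 0 <= z by have := h 0; rewrite expr0n !mulr0 !add0r.
split=> [|x0].
  (* Since [x s = x - z] and [s >= 1], the mean of the values at [s] and [- s] is at most
     [x < 0]. *)
  rewrite leNgt; apply/negP => x0; pose s := 1 - z / x.
  have hs : x * s = x - z by rewrite /s mulrBr mulr1 mulrCA divff ?mulr1 // lt_eqF.
  have s1 : 1 <= s by rewrite /s lerDl oppr_ge0 mulr_ge0_le0 // invr_le0 ltW.
  have h1 := h s; have h2 := h (- s).
  have h3 : x * s ^+ 2 = x * s * s by rewrite -mulrA.
  rewrite sqrrN h3 hs in h1 h2; nra.
(* At this point the affine function [2 y s + z] equals -1. *)
apply/eqP; apply: contraT => y0; have := h (- (z + 1) / (2 * y)); rewrite x0 mul0r add0r.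
rewrite [2 * y * _]mulrC divfK ?mulf_neq0 ?pnatr_eq0 //; lra.
Qed.

End NullTensors.

Arguments null_vec {R}.

(** * Null eigenvectors and the equivalence *)

Section Null.
Variable R : realType.
Implicit Types (g T M P A : 'M[R]_5) (u v w : 'cV[R]_5).
Notation eta := (minkowski5 R).

Lemma null5_tr (l a b1 b2 b3 p1 p2 p3 : R) (T := null5 l a b1 b2 b3 p1 p2 p3) :
  \tr T = - l + - l + p1 + p2 + p3 /\
  \tr (T *m T) = l ^+ 2 + (- l) ^+ 2 + p1 ^+ 2 + p2 ^+ 2 + p3 ^+ 2.
Proof.
rewrite /mxtrace !sum5; split; first by rewrite !mxE /=; ring.
by rewrite !mxE !sum5 !mxE /=; ring.
Qed.

Lemma null5_vec (l a b1 b2 b3 p1 p2 p3 : R) :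
  null5 l a b1 b2 b3 p1 p2 p3 *m null_vec = - l *: null_vec.
Proof. by apply/colP; apply: forall5; rewrite mxE sum5 !mxE /=; ring. Qed.

(* The square of the 2-form [x k^e2 + w (e3 + y3 k)^(e4 + y4 k)] with [k = e0 + e1] null,
   [w^2 = 2 l], [y_j = - b_j / (2 l)] and [x^2 = a - (b2^2 + b3^2) / (2 l)]; when [l = 0] the
   quotients are [0] by convention. *)
Lemma minus_square_null5_residual (l a b2 b3 : R) : 0 <= l -> (l = 0 -> b2 = 0 /\ b3 = 0) ->
  0 <= a - (b2 ^+ 2 + b3 ^+ 2) / (2 * l) -> minus_square (null5 l a 0 b2 b3 (- l) l l).
Proof.
move=> l0 hl ha; have [htr _] := null5_tr l a 0 b2 b3 (- l) l l.
rewrite /minus_square htr.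
pose w := Num.sqrt (2 * l); pose x := Num.sqrt (a - (b2 ^+ 2 + b3 ^+ 2) / (2 * l)).
have hw : w * w = 2 * l by rewrite -expr2 sqr_sqrtr // mulr_ge0.
have hx : x * x = a - (b2 ^+ 2 + b3 ^+ 2) / (2 * l) by rewrite -expr2 sqr_sqrtr.
pose z2 := w * (b2 / (2 * l)); pose z3 := w * (b3 / (2 * l)).
have hz2 : w * z2 = b2.
  rewrite /z2 mulrA hw; have [l00|ln0] := eqVneq l 0; first by rewrite (hl l00).1 l00 !mul0r mulr0.
  by field.
have hz3 : w * z3 = b3.
  rewrite /z3 mulrA hw; have [l00|ln0] := eqVneq l 0; first by rewrite (hl l00).2 l00 !mul0r mulr0.
  by field.
have hzz : x * x + z2 * z2 + z3 * z3 = a.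
  have -> : z2 * z2 = w * z2 * (b2 / (2 * l)) by rewrite {2}/z2; ring.
  have -> : z3 * z3 = w * z3 * (b3 / (2 * l)) by rewrite {2}/z3; ring.
  by rewrite hz2 hz3 hx; ring.
exists (so14 0 x z3 (- z2) x z3 (- z2) 0 0 w); split; first by apply/so14P; do 10!eexists.
rewrite -hzz -hz2 -hz3.
clearbody x w z2 z3; have -> : l = w * w / 2 by rewrite hw; field.
by apply/matrixP; do 2![apply: forall5]; rewrite !mxE sum5 !mxE /=; field.
Qed.

(** The spectrum is [- l, - l, t, l, l]. If [l + t] is nonzero, a timelike eigenvector exists;
    otherwise the energy inequality supplies what the null rotation requires. *)
Lemma minus_square_null5 (l a b1 b2 b3 p1 p2 p3 : R) (T := null5 l a b1 b2 b3 p1 p2 p3)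
    (c := 4^-1 * \tr (T *m T) - 4^-1 * (\tr T) ^+ 2) :
  g_symmetric eta T -> cone_dominant T -> condition_b T -> p1 <= p2 -> p2 <= p3 ->
  (p1 ^+ 2 - c) * (p1 - \tr T) = 0 -> (p2 ^+ 2 - c) * (p2 - \tr T) = 0 ->
  (p3 ^+ 2 - c) * (p3 - \tr T) = 0 -> minus_square T.
Proof.
move=> hs hD hb h1 h2 q1 q2 q3.
have [hk kn0 hkk] := null_vec_cone R.
have ql := eigen_cubic kn0 (null5_vec l a b1 b2 b3 p1 p2 p3) hb; rewrite -/T -/c in ql.
have ql' := ql; rewrite sqrrN in ql'.
have hdec s1 s2 s3 := null5_dec s1 s2 s3 hD.
have [htr htr2] := null5_tr l a b1 b2 b3 p1 p2 p3; rewrite -/T in htr htr2.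
have hc : 4 * c = l ^+ 2 + (- l) ^+ 2 + p1 ^+ 2 + p2 ^+ 2 + p3 ^+ 2 - (\tr T) ^+ 2.
  by rewrite /c htr2; field.
(* Along each axis a nonnegative quadratic whose leading coefficient vanishes has no linear term. *)
have [a1 hb1] : 0 <= l + p1 /\ (l + p1 = 0 -> b1 = 0).
  by apply: (quadratic_ge0 (z := a)) => s; have := (hdec s 0 0).1; lra.
have [_ hb2] : 0 <= l + p2 /\ (l + p2 = 0 -> b2 = 0).
  by apply: (quadratic_ge0 (z := a)) => s; have := (hdec 0 s 0).1; lra.
have [_ hb3] : 0 <= l + p3 /\ (l + p3 = 0 -> b3 = 0).
  by apply: (quadratic_ge0 (z := a)) => s; have := (hdec 0 0 s).1; lra.
have [a3 _] : 0 <= l - p3 /\ (l - p3 = 0 -> 0 = 0 :> R).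
  by apply: (quadratic_ge0 (z := a)) => s; have := (hdec 0 0 s).2; lra.
have hp1 : - l <= p1 by lra.
have hp3 : p3 <= l by lra.
(* The eigenvalue [- l] counts twice, its second copy as the smallest of the four; both alternatives
   then agree on the remaining values. *)
have := spectrum_dichotomy htr hc (lexx _) hp1 h1 h2 hp3 ql' ql q1 q2 q3.
set t := \tr T => hsp.
have {hsp} [e1 e2 e3] : [/\ p1 = t, p2 = l & p3 = l].
  by case: hsp => [[_ e1 e2 e3]|[e1 e2 e3 e4]]; split; lra.
have [lt0|lt0] := eqVneq (l + t) 0; last first.
  have ln0 : l != 0.
    by apply: contra lt0 => /eqP l00; apply/eqP; lra.
  have hcl : c = l ^+ 2.
    move/eqP: ql'; rewrite -/t mulf_eq0 -opprD oppr_eq0 (negPf lt0) orbF subr_eq0.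
    by move/eqP => ->.
  have hb' := (condition_bE T).1 hb; rewrite -/c -/t hcl in hb'.
  have [v hv hvv] := timelike_eigenvector_of_null hs hb' hk kn0 hkk
    (null5_vec l a b1 b2 b3 p1 p2 p3) ln0 lt0.
  exact: minus_square_timelike hs hD hb hv hvv.
have htl : p1 = - l by lra.
rewrite /T hb1 ?htl ?e2 ?e3; last by lra.
have l0 : 0 <= l by lra.
apply: minus_square_null5_residual => //.
  by move=> l00; rewrite hb2 ?hb3 //; lra.
have [l00|ln0] := eqVneq l 0.
  by rewrite l00 mulr0 invr0 mulr0 subr0; have := (hdec 0 0 0).1; lra.
(* The minimizer in the last two variables, where the quadratic equals
   [a - (b2^2 + b3^2) / (2 l)]. *)
have := (hdec 0 (- b2 / (2 * l)) (- b3 / (2 * l))).1.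
rewrite e2 e3; set X := (X in 0 <= X -> _); set Y := (Y in _ -> 0 <= Y).
by have -> : X = Y by rewrite /X /Y; field.
Qed.

Lemma eta_block23 : exists G : 'M[R]_2, eta = block_mx G 0 0 1%:M :> 'M_(2 + 3).
Proof.
exists (@ulsubmx R 2 3 2 3 eta).
rewrite -[LHS](@submxK R 2 3 2 3); congr block_mx; apply/matrixP => i j; rewrite !mxE //.
- by case: (unliftP ord0 i) => [k|] ->; rewrite // (ord1 k).
- by case: (unliftP ord0 j) => [k|] ->; rewrite // (ord1 k).
- by rewrite (inj_eq (@rshift_inj 2 3)); case: (i == j).
Qed.

Lemma rshift23 (i : 'I_3) : rshift 2 i = lift ord0 (lift ord0 i) :> 'I_5.
Proof. exact: val_inj. Qed.

Lemma lshift23 (i : 'I_2) : lshift 3 i = (if i == ord0 then o0 else o1) :> 'I_5.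
Proof. by case: (unliftP ord0 i) => [k|] ->; rewrite ?(ord1 k); exact: val_inj. Qed.

Lemma rotation23 (O : 'M[R]_3) (E : 'M[R]_5 := @block_mx R 2 3 2 3 1%:M 0 0 O) :
  O^T *m O = 1%:M -> [/\ lorentz E, E^T *m E = 1%:M, E *m e0 = e0 & E *m null_vec = null_vec].
Proof.
move=> hO; have hl (i j : 'I_2) : E (lshift 3 i) (lshift 3 j) = (i == j)%:R.
  by have := @block_mxEul R 2 3 2 3 1%:M 0 0 O i j; rewrite -/E => ->; rewrite mxE.
have hd (i : 'I_3) (j : 'I_2) : E (rshift 2 i) (lshift 3 j) = 0.
  by have := @block_mxEdl R 2 3 2 3 1%:M 0 0 O i j; rewrite -/E => ->; rewrite mxE.
have h0 i : E i o0 = (i == o0)%:R.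
  case: (@split_ordP 2 3 i) => k ->; rewrite -[o0 in E _ o0](lshift23 ord0) ?hd ?hl ?rshift23 //.
have h1 i : E i o1 = (i == o1)%:R.
  case: (@split_ordP 2 3 i) => k ->; rewrite -[o1 in E _ o1](lshift23 ord_max) ?hd ?hl ?rshift23 //.
split.
- have [G hG] := eta_block23.
  by have := @block_rotation R 2 3 G _ hO; rewrite -hG.
- have := @block_rotation R 2 3 1%:M _ hO; rewrite -scalar_mx_block mulmx1; exact.
- by apply/colP => i; rewrite -colE mxE e0E h0.
apply/colP => i; rewrite mxE sum5 h0 h1 !mxE /= !mulr0 !addr0 !mulr1.
by move: i; apply: forall5; rewrite /= ?addr0 ?add0r.
Qed.

(** Scaled to unit time component, [k] has a unit spatial part, which a rotation takes to [e1]. A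
    rotation of [e2], [e3], [e4] fixes [e0 + e1] and brings [T] to the form [null5]. *)
Lemma minus_square_null T k r : g_symmetric eta T -> cone_dominant T -> condition_b T ->
  cone k -> k != 0 -> bil eta k k = 0 -> T *m k = r *: k -> minus_square T.
Proof.
move=> hs hD hb hk kn0 hkk hTk; have k0 := cone_gt0 hk kn0.
have [y [hTy y0 hyy]] : exists y, [/\ T *m y = r *: y, y o0 0 = 1 & bil eta y y = 0].
  exists ((k o0 0)^-1 *: k); split; first by rewrite -scalemxAr hTk !scalerA mulrC.
    by rewrite mxE mulVf // gt_eqF.
  by rewrite bilZ1 bilZ2 hkk !mulr0.
pose x : 'cV[R]_4 := \col_i y (lift ord0 i) 0.
have hx : bil 1%:M x x = 1.
  have -> : bil 1%:M x x = spatial_sqr y.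
    by rewrite bil1E !big_ord_recl big_ord0 addr0 !mxE /spatial_sqr !addrA.
  by move: hyy; rewrite eta_diagE y0 expr1n => /eqP; rewrite subr_eq0 => /eqP.
have [Q [hQ hQe]] := orthogonal_frame hx.
have [hE hEE hEe] := rotation14 hQ; set E := block_mx _ _ _ _ in hE hEE hEe.
have hEu := lorentz_unit hE.
have hEk : E *m null_vec = y.
  have -> : null_vec = e0 + delta_mx o1 0 :> 'cV[R]_5.
    by apply/colP; apply: forall5; rewrite !mxE /= ?addr0 ?add0r.
  rewrite mulmxDr hEe; apply/colP => i; rewrite mxE e0E -colE mxE.
  case: (unliftP ord0 i) => [j|] ->.
    have := @block_mxEdr R 1 4 1 4 1%:M 0 0 Q j ord0; rewrite !rshift14 -/E => ->.
    by rewrite add0r; have /colP/(_ j) := hQe; rewrite -colE !mxE.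
  have := @block_mxEur R 1 4 1 4 1%:M 0 0 Q ord0 ord0; rewrite rshift14 lshift14 -/E => ->.
  by rewrite mxE addr0 y0.
have hTe := in_frame_eigen hEu hEk hTy.
apply: (minus_square_lorentz hE).
have hs' := g_symmetric_lorentz hE hs.
have hD' : cone_dominant (in_frame E T).
  by apply: cone_dominant_lorentz => //; rewrite hEe; exact: cone_e0.
have hb' := (condition_b_frame T hEu).1 hb.
move: (in_frame E T) hTe hs' hD' hb'.
move=> {T hs hD hb k hk kn0 hkk hTk k0 y hTy y0 hyy x hx Q hQ hQe E hE hEE hEe hEu hEk}.
move=> T hTe hs hD hb.
(* Symmetry and the eigenvector equation leave a single free entry in the corner on [e0], [e1]. *)
have hblock M : g_symmetric eta M -> M *m null_vec = r *: null_vec ->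
    [/\ forall i : 'I_3, M (lift ord0 (lift ord0 i)) o1 = - M (lift ord0 (lift ord0 i)) o0,
        M o0 o0 = r - M o0 o1, M o1 o0 = - M o0 o1 & M o1 o1 = r + M o0 o1].
  move=> hM hMk; have [hM0 _] := eta_sym_entry hM.
  have hrow i : M i o0 + M i o1 = r * null_vec i 0.
    by have /colP/(_ i) := hMk; rewrite mxE sum5 !mxE /= !mulr0 !addr0 !mulr1.
  have h01 := hM0 o1 isT.
  have hz (i : 'I_3) : null_vec (lift ord0 (lift ord0 i)) 0 = 0.
    by rewrite mxE; case: i => -[|[|[|]]].
  split=> [i|||].
  - by have := hrow (lift ord0 (lift ord0 i)); rewrite hz; lra.
  - by have := hrow o0; rewrite mxE /=; lra.
  - by lra.
  - by have := hrow o1; rewrite mxE /=; lra.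
have hcubic M : g_symmetric eta M -> M *m null_vec = r *: null_vec -> condition_b M ->
    (@drsubmx R 2 3 2 3 M *m @drsubmx R 2 3 2 3 M
      - (4^-1 * \tr (M *m M) - 4^-1 * (\tr M) ^+ 2)%:M)
      *m (@drsubmx R 2 3 2 3 M - (\tr M)%:M) = 0.
  move=> hM hMk /condition_bE; have [hM0 hMM] := eta_sym_entry hM.
  have [hc h00 h10 h11] := hblock _ hM hMk.
  (* The rows of the lower left block are multiples of [(1, - 1)]: they annihilate the upper right
     block, whose two rows agree, and are left eigenvectors of the corner for [r]. *)
  apply: (@block_cubic R 2 3 M r); apply/matrixP => i j.
    rewrite !mxE !big_ord_recl big_ord0 addr0 !mxE !lshift23 /= !rshift23 hc.
    by rewrite [M o0 _]hM0 // [M o1 _]hMM // hc; ring.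
  rewrite !mxE !big_ord_recl big_ord0 addr0 !mxE !lshift23 /= !rshift23 hc.
  by case: (unliftP ord0 j) => [m|] -> /=; rewrite ?hc ?h00 ?h10 ?h11; ring.
have [_ hss] := eta_sym_entry hs.
have [|O [d [hO hd hsort]]] := spectral_cubic_sorted _ (hcubic _ hs hTe hb).
  by apply/matrixP => i j; rewrite !mxE hss // rshift23.
have [hE hEE hEe hEk] := rotation23 hO; set E := block_mx _ _ _ _ in hE hEE hEe hEk.
have hEu := lorentz_unit hE; apply: (minus_square_lorentz hE).
have hTe' := in_frame_eigen hEu hEk hTe.
have hs' := g_symmetric_lorentz hE hs.
have hD' : cone_dominant (in_frame E T).
  by apply: cone_dominant_lorentz => //; rewrite hEe; exact: cone_e0.
have hb' := (condition_b_frame T hEu).1 hb.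
have hdr : @drsubmx R 2 3 2 3 (in_frame E T) = diag_mx d.
  by rewrite orthogonal_lorentz // /E block_conj hd.
move: (in_frame E T) hTe' hs' hD' hb' hdr => {T hTe hs hD hb hss E hE hEE hEe hEk hEu hd O hO}.
move=> T hTe hs hD hb hdr; have [hs0 hss] := eta_sym_entry hs.
have [hc h00 h10 h11] := hblock _ hs hTe.
have hTd i j : T (lift ord0 (lift ord0 i)) (lift ord0 (lift ord0 j)) = diag_mx d i j.
  by rewrite -hdr !mxE !rshift23.
have hT1 i : T o1 (lift ord0 (lift ord0 i)) = - T (lift ord0 (lift ord0 i)) o0.
  by rewrite hss // hc.
have hTE : T = null5 (- r) (T o0 o1) (T o2 o0) (T o3 o0) (T o4 o0)
    (d 0 ord0) (d 0 (lift ord0 ord0)) (d 0 (lift ord0 (lift ord0 ord0))).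
  apply/matrixP; do 2![apply: forall5]; rewrite [RHS]mxE /= ?opprK ?hTd ?hT1 ?hc ?h00 ?h10 ?h11
    ?[T o0 (lift _ (lift _ _))]hs0 // ?mxE //=; ring.
have hq i : (d 0 i ^+ 2 - (4^-1 * \tr (T *m T) - 4^-1 * \tr T ^+ 2)) * (d 0 i - \tr T) = 0.
  by rewrite -diag_mx_cubic -hdr hcubic // mxE.
by rewrite hTE; apply: minus_square_null5; rewrite -?hTE //; exact: hsort.
Qed.

Lemma minus_square_iff T : g_symmetric eta T -> minus_square T <-> cone_dominant T /\ condition_b T.
Proof.
move=> hs; split=> [hT|[hD hb]].
  by split; [exact: minus_square_dec | exact: minus_square_condition_b].
have [k [r [hk kn0 hTk]]] := causal_eigenvector hs hD hb.
have [hkk|hkk] := ltrP (bil eta k k) 0; first exact: minus_square_timelike hTk hkk.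
by apply: (minus_square_null hs hD hb hk kn0 _ hTk); apply/eqP; rewrite eq_le hkk; case: hk => _ ->.
Qed.

End Null.

Theorem theorem7 (R : realType) (g T : 'M[R]_5) (tau : 'cV[R]_5) :
  lorentz_metric g -> timelike g tau -> g_symmetric g T ->
  (is_superenergy g T <-> dominant_energy g tau T /\ condition_b T).
Proof.
move=> hg htau hs; have [P [t [hP hPg -> ht htt]]] := lorentz_frame_ex hg htau.
have hgu : g \in unitmx.
  have := eta_unit R; rewrite -hPg !unitmx_mul => /andP [/andP []] //.
have hs' := g_symmetric_frame hP hs; rewrite hPg in hs'.
rewrite (dominant_energy_frame _ hP hPg ht htt) (condition_b_frame T hP).
by rewrite (is_superenergy_frame T hP hgu) hPg is_superenergy_eta; exact: minus_square_iff.
Qed.
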